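(* Let $n\ge 1$ and $k\in\{0,1,\dots,n-1\}$. Let $V$ and $V'$ be $2n$-dimensional vector spaces over fields $F$ and $F'$, with non-degenerate symplectic forms $\Omega$ on $V$ and $\Omega'$ on $V'$, and let $\Pi=(P,\mathcal L)$, $\Pi'=(P',\mathcal L')$ be the associated $(2n-1)$-dimensional projective spaces. Let $\mathcal G_k$ and $\mathcal G'_k$ be the sets of $k$-dimensional totally isotropic subspaces of $\Pi$ and $\Pi'$. If a mapping $f:\mathcal G_k\to\mathcal G'_k$ sends every base subset of $\mathcal G_k$ to a base subset of $\mathcal G'_k$, then there is a symplectic embedding $h$ of $\Pi$ to $\Pi'$ such that $f(S)=\overline{h(S)}$ for all $S\in\mathcal G_k$.
   Context: Points of $\Pi$ are the $1$-dimensional subspaces of $V$, lines are given by $2$-dimensional subspaces; a $k$-dimensional (projective) subspace of $\Pi$ corresponds to a $(k+1)$-dimensional linear subspace of $V$. Points $p=\langle x\rangle,q=\langle y\rangle$ are orthogonal ($p\perp q$) if $\Omega(x,y)=0$; subspaces $S,U$ are orthogonal if all their points are pairwise orthogonal. A subspace is totally isotropic if any two of its points are orthogonal. A symplectic base of $\Pi$ is a base $\{p_1,\dots,p_{2n}\}$ of $\Pi$ (points $\langle x_i\rangle$ with $x_1,\dots,x_{2n}$ a basis of $V$) such that for each $i$ there is a unique $\sigma(i)$ with $p_i\not\perp p_{\sigma(i)}$. The base subset of $\mathcal G_k$ associated with a symplectic base $B$ is the set of all $k$-dimensional totally isotropic subspaces spanned by points of $B$. The same notions are used for $\Pi'$.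 An embedding of $\Pi$ to $\Pi'$ is an injection $h:P\to P'$ mapping every line into a line such that for each line $L'$ of $\Pi'$ there is at most one line $L$ of $\Pi$ with $h(L)\subset L'$; it is symplectic if it sends symplectic bases of $\Pi$ to symplectic bases of $\Pi'$. $\overline{X}$ denotes the subspace spanned by $X$. *)

(* Defs.v *)
From mathcomp Require Import all_boot all_order all_algebra.
From mathcomp Require Import boolp classical_sets.

Set Implicit Arguments.
Unset Strict Implicit.
Unset Printing Implicit Defensive.

Local Open Scope classical_set_scope.
Local Open Scope ring_scope.

(* Projective subspaces are the linear subspaces of V; projective dimension   *)
(* is linear dimension minus one.                                             *)
Section ProjectiveSpace.
Variables (F : fieldType) (V : vectType F).

Definition psubspace (d : nat) : Type := {U : {vspace V} | \dim U == d.+1}.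
Definition proj_point : Type := psubspace 0.
Definition proj_line : Type := psubspace 1.

Definition points_of (U : {vspace V}) : set proj_point :=
  [set p | (val p <= U)%VS].

(* U is the smallest subspace containing the (possibly infinite) set X; this  *)
(* determines U.                                                              *)
Definition spanned_by (X : set proj_point) (U : {vspace V}) : Prop :=
  X `<=` points_of U /\
  forall W : {vspace V}, X `<=` points_of W -> (U <= W)%VS.

Definition projective_base (p : 'I_(\dim {:V}) -> proj_point) : Prop :=
  exists2 x : (\dim {:V}).-tuple V,
    basis_of {:V} x & forall i, val (p i) = <[tnth x i]>%VS.

End ProjectiveSpace.

Section Symplectic.
Variables (F : fieldType) (V : vectType F) (Omega : {skew_symmetric V}).

(* For p = <[x]> and q = <[y]> this is Omega x y == 0: see orthov11.          *)
Definition orthogonal_points (p q : proj_point V) : bool :=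
  (val p <= orthov Omega (val q))%VS.

Definition totally_isotropic (U : {vspace V}) : Prop :=
  forall p q : proj_point V,
    points_of U p -> points_of U q -> orthogonal_points p q.

Definition isotropic_grassmannian (k : nat) : set {vspace V} :=
  [set U | \dim U = k.+1 /\ totally_isotropic U].

Definition symplectic_base (B : set (proj_point V)) : Prop :=
  exists p : 'I_(\dim {:V}) -> proj_point V,
    [/\ projective_base p,
        forall i, exists! j, ~~ orthogonal_points (p i) (p j)
      & B = range p].

Definition base_subset_of (k : nat) (B : set (proj_point V)) :
    set (isotropic_grassmannian k) :=
  [set S | exists2 A : set (proj_point V), A `<=` B & spanned_by A (val S)].

Definition base_subset (k : nat) (X : set (isotropic_grassmannian k)) : Prop :=
  exists2 B, symplectic_base B & X = base_subset_of B.

End Symplectic.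

Section Embedding.
Variables (F F' : fieldType) (V : vectType F) (V' : vectType F').
Variables (Omega : {skew_symmetric V}) (Omega' : {skew_symmetric V'}).

Definition maps_into (h : proj_point V -> proj_point V') (L : proj_line V) (L' : proj_line V') :
    Prop :=
  h @` points_of (val L) `<=` points_of (val L').

Definition embedding (h : proj_point V -> proj_point V') : Prop :=
  [/\ injective h,
      forall L, exists L', maps_into h L L'
    & forall L' L1 L2, maps_into h L1 L' -> maps_into h L2 L' -> L1 = L2].

Definition symplectic_embedding (h : proj_point V -> proj_point V') : Prop :=
  embedding h /\
  forall B, symplectic_base Omega B -> symplectic_base Omega' (h @` B).

End Embedding.

(* Main.v *)
Require Import Defs.
From mathcomp Require Import boolp classical_sets.
From mathcomp Require Import all_boot all_order all_algebra zify.

(* Encode a symplectic base by vectors e i indexed by signed indices i, with  *)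
(* e i orthogonal to every e j except e (flip i), so that a base subset is    *)
(* indexed by the isotropic m-subsets A of the index set, m = k + 1. On each  *)
(* base, f is then a permutation phi of these subsets.                        *)
(*   A family of m-subsets whose spans lie in a second base subset can be     *)
(* characterized combinatorially: its complement contains the half-set of     *)
(* some root of type C_n. Since f sends distinct base subsets to distinct     *)
(* base subsets, phi permutes the upward closed family generated by the       *)
(* half-sets, hence the minimal half-sets; except for m = 1 and n = m = 2     *)
(* this forces phi to preserve the relation B = A - i + flip i. In the        *)
(* exceptional cases this follows by comparing three bases which pairwise     *)
(* differ in only two elements of their base subsets.                         *)
(*   So f preserves the pairs U + <x>, U + <y> with x, y a hyperbolic pair in *)
(* the orthogonal of U, and f (U + <x>) :&: f (U + <y>) depends on U only.    *)
(* This defines a map on (k-1)-dimensional subspaces which sends base subsets *)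
(* to base subsets; iterating yields h on points. It preserves orthogonality  *)
(* and non-orthogonality, hence lines, as a line is the orthogonal of the     *)
(* points of a base that are orthogonal to it.                                *)

Set Implicit Arguments.
Unset Strict Implicit.
Unset Printing Implicit Defensive.

Import GRing.Theory.

(** * Signed sets *)

(** Any isotropic subspace, and any hyperbolic pair in its orthogonal, fits into a frame by a
    Witt-type extension ([ext_isov]). So it suffices to study the permutation [phi] of signed sets
    on one frame and to compare frames. The only comparisons are between [e], [transv e i j] and
    [transv e j i], which differ by root elements: members outside the half-set of the root are
    unchanged ([transv_over]), and the new members of the last two frames are related by a
    reflection ([transv_swap]). This gives [base_map_half] and [base_map_flips]. The combinatorial
    lemmas [neighbours_generic], [neighbours_full], [neighbours1] and [neighbours2] turn them into
    [base_map_neighbours].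

    In terms of subspaces, neighbours meet in a common hyperplane and are not orthogonal
    ([hyper_adjacent]). Three such subspaces, pairwise adjacent, share one intersection
    ([hyper_adjacent_cap]). Moving along non-orthogonal pairs in the orthogonal of [U] then gives
    [hyper_cap_const], hence [descent] and, by iteration, a map on points ([descent_to_points]).

    The point map carries each frame to a frame ([point_frame]). Two points always lie in a common
    frame ([common_frame]), so orthogonality is preserved and reflected ([point_map_orth]). A
    subspace spanned by part of a frame is cut out by orthogonality to frame points ([sub_spanf]),
    so lines are respected. Finally [f S] contains the images of frame points spanning [S] and has
    the right dimension. *)

(** The injection [X |-> phi @: X] sends the upward closure [U] of [C] into itself, hence onto
    itself by finiteness. A member of [C] inside [phi @: D] is thus the image of some [X] in [U],
    and minimality of [D] forces [X = D]. *)
Lemma antichain_imset (T : finType) (phi : T -> T) (C : {set {set T}}) :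
  injective phi ->
  {in C &, forall D E : {set T}, D \subset E -> D = E} ->
  (forall D : {set T}, D \in C -> exists2 E, E \in C & E \subset phi @: D) ->
  forall D : {set T}, D \in C -> phi @: D \in C.
Proof.
move=> phi_inj antiC phiC D DC.
pose U : {set {set T}} := [set X : {set T} | [exists E in C, E \subset X]].
have UP (X : {set T}) : reflect (exists2 E, E \in C & E \subset X) (X \in U).
  by rewrite inE; exact: exists_inP.
pose im := fun X : {set T} => phi @: X.
have im_inj : injective im by exact: imset_inj.
have UU : im @: U = U.
  apply/eqP; rewrite eqEcard card_imset // leqnn andbT.
  apply/subsetP => _ /imsetP[X /UP[E EC EX] ->].
  have [E' E'C E'E] := phiC _ EC.
  by apply/UP; exists E' => //; apply: subset_trans E'E (imsetS _ EX).
have [E EC ED] := phiC _ DC.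
have : E \in U by apply/UP; exists E.
rewrite -UU => /imsetP[X /UP[E' E'C E'X]]; rewrite /im => defE.
have XD : X \subset D.
  apply/subsetP => x xX.
  have : phi x \in phi @: D by apply: (subsetP ED); rewrite defE imset_f.
  by rewrite mem_imset.
have E'D := antiC _ _ E'C DC (subset_trans E'X XD).
suff -> : D = X by rewrite -defE.
by apply/eqP; rewrite eqEsubset XD -E'D E'X.
Qed.

Lemma subset_of_size (T : finType) (X A : {set T}) m :
  X \subset A -> #|X| <= m <= #|A| ->
  exists B : {set T}, [/\ X \subset B, B \subset A & #|B| = m].
Proof.
move=> XA /andP[Xm mA]; move: m Xm mA.
elim=> [|m IH] Xm mA; first by exists X; split=> //; lia.
move: Xm; rewrite leq_eqVlt => /orP[/eqP Xm|Xm]; first by exists X.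
have [B [XB BA Bm]] := IH Xm (ltnW mA).
have /subsetPn[x xA xB] : ~~ (A \subset B).
  by apply/negP => /subset_leq_card; lia.
exists (x |: B); split; first by rewrite (subset_trans XB) ?subsetUr.
  by rewrite subUset sub1set xA.
by rewrite cardsU1 xB Bm.
Qed.

Section SignedSets.
Variable n : nat.

Definition idx := ('I_n * bool)%type.
Implicit Types (i j k l : idx) (A B X : {set idx}).

Definition flip i : idx := (i.1, ~~ i.2).

Lemma flipK : involutive flip.
Proof. by case=> i b; rewrite /flip /= negbK. Qed.

Lemma flip_inj : injective flip.
Proof. exact: inv_inj flipK. Qed.

Lemma flip_neq i : (flip i == i) = false.
Proof. by case: i => i []; rewrite /flip xpair_eqE /= andbF. Qed.

Lemma eq_flip i j : (flip i == j) = (i == flip j).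
Proof. exact: inv_eq flipK i j. Qed.

Lemma eq_flipC i j : (i == flip j) = (j == flip i).
Proof. by rewrite -eq_flip eq_sym. Qed.

Definition flips A := [set i | flip i \in A].

Lemma mem_flips A i : (i \in flips A) = (flip i \in A).
Proof. by rewrite inE. Qed.

Lemma flipsK : involutive flips.
Proof. by move=> A; apply/setP => i; rewrite !inE flipK. Qed.

Lemma card_flips A : #|flips A| = #|A|.
Proof. by apply: on_card_preimset; exists flip => i _; rewrite flipK. Qed.

Definition isotropic A := [forall i in A, flip i \notin A].

Lemma isotropicP A :
  reflect (forall i, i \in A -> flip i \notin A) (isotropic A).
Proof. exact: forall_inP. Qed.

Lemma card_idx : #|{: idx}| = n.*2.
Proof. by rewrite card_prod card_ord card_bool muln2. Qed.

Lemma isotropic_disjoint A : isotropic A -> A :&: flips A = set0.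
Proof.
move/isotropicP=> isoA; apply/setP => i; rewrite !inE.
by apply/negP => /andP[/isoA/negP].
Qed.

Lemma isotropic_cardU A : isotropic A -> #|A :|: flips A| = #|A|.*2.
Proof.
by move=> isoA; rewrite cardsU isotropic_disjoint // cards0 card_flips; lia.
Qed.

Lemma isotropicS A B : B \subset A -> isotropic A -> isotropic B.
Proof.
move=> /subsetP BA /isotropicP isoA; apply/isotropicP => i iB.
by apply: contra (isoA _ (BA _ iB)) => /BA.
Qed.

Lemma isotropic_flips A : isotropic A -> isotropic (flips A).
Proof.
move/isotropicP=> isoA; apply/isotropicP => i.
by rewrite !mem_flips => /isoA.
Qed.

Lemma isotropic1 i : isotropic [set i].
Proof. by apply/isotropicP => j /set1P ->; rewrite inE flip_neq. Qed.

Lemma isotropic2 i j : j != flip i -> isotropic [set i; j].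
Proof.
move=> ij; apply/isotropicP => k; rewrite !inE.
case/orP=> /eqP ->; rewrite negb_or flip_neq /=; last by rewrite eq_flip ij.
by rewrite eq_sym.
Qed.

Lemma isotropicU1 i A :
  isotropic A -> flip i \notin A -> isotropic (i |: A).
Proof.
move=> /isotropicP isoA iA; apply/isotropicP => j; rewrite !inE eq_flip.
case/orP=> [/eqP ->|jA]; first by rewrite eq_sym flip_neq.
rewrite negb_or isoA // andbT; apply: contraNneq iA => <-; exact: jA.
Qed.

Definition admissible m := [set A | isotropic A && (#|A| == m)].

Lemma admissibleP m A :
  reflect (isotropic A /\ #|A| = m) (A \in admissible m).
Proof. by rewrite inE; apply: (iffP andP) => -[? /eqP]. Qed.

Lemma admissible_flips m A : A \in admissible m -> flips A \in admissible m.
Proof.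
case/admissibleP=> isoA cA; apply/admissibleP.
by rewrite isotropic_flips // card_flips.
Qed.

(** Avoiding [z] and [w] costs an element only when they are opposite, hence the strict bound in
    that case. Taking [w = z] avoids a single element. *)
Lemma ex_admissible m X z w :
  isotropic X -> #|X| <= m -> m <= n -> z \notin X -> w \notin X ->
  (w != flip z) || (m < n) ->
  exists A, [/\ A \in admissible m, X \subset A, z \notin A & w \notin A].
Proof.
move=> isoX Xm mn zX wX zw.
pose Y := if w == flip z then [set z] else [set z; w].
have zY : z \in Y by rewrite /Y; case: ifP => _; rewrite !inE eqxx.
have isoY : isotropic Y.
  by rewrite /Y; case: ifPn => [_|/isotropic2//]; exact: isotropic1.
have XY i : i \in X -> i \notin Y.
  move=> iX; apply: contraTN iX; rewrite /Y.
  by case: ifP => _; rewrite !inE; [move/eqP->|case/orP=> /eqP->].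
(* From each pair [i], [flip i], the full isotropic set [A0] takes the member in [X], else the
   opposite of the member in [Y], else the one with sign [false]. *)
pose A0 := [set i | (i \in X) ||
  [&& flip i \notin X, i \notin Y & ~~ i.2 || (flip i \in Y)]].
have isoA0 : isotropic A0.
  apply/isotropicP => i; rewrite !inE flipK.
  case/orP=> [iX|/and3P[fX iY iXY]].
    by rewrite negb_or ((isotropicP _ isoX)) // iX.
  rewrite negb_or fX /= (negPf iY) orbF.
  case: (i \in X) => //=; apply/negP => /andP[fY]; rewrite negbK => i2.
  by move: iXY; rewrite (negPf fY) i2.
have cA0 : #|A0| = n.
  apply: double_inj; rewrite -isotropic_cardU // -card_idx.
  rewrite -cardsT; apply: eq_card => i; rewrite !inE flipK.
  case: (boolP (i \in X)) => //= iX; case: (boolP (flip i \in X)) => //= fX.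
  case: (boolP (i \in Y)) => [iY|_] /=.
    by rewrite (isotropicP _ isoY _ iY) orbT.
  case: (flip i \in Y); rewrite ?orbT ?orbF //=.
  by case: (i.2).
have XA0 : X \subset A0 by apply/subsetP => i iX; rewrite inE iX.
have A0Y i : i \in Y -> i \notin A0.
  move=> iY; rewrite inE iY andbF orbF.
  by apply: contraTN iY => /XY.
have XA1 : X \subset A0 :\ w by rewrite subsetD1 XA0.
have cA1 : m <= #|A0 :\ w|.
  have := cardsD1 w A0; rewrite cA0; move: zw A0Y; rewrite /Y.
  have [_ /= mn' _|_ _ A0Y] := eqVneq w (flip z); first by case: (w \in A0); lia.
  have /negPf-> : w \notin A0 by apply: A0Y; rewrite !inE eqxx orbT.
  by lia.
have [|B [XB BA cB]] := @subset_of_size _ X (A0 :\ w) m XA1; first lia.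
have BA0 : B \subset A0 by apply: subset_trans BA (subsetDl _ _).
exists B; split=> //.
- by apply/admissibleP; split=> //; apply: isotropicS isoA0.
- by apply: contra (A0Y _ zY) => /(subsetP BA0).
- by apply/negP => /(subsetP BA); rewrite !inE eqxx.
Qed.

(* With v(i) = 1, -1, 0 according as i is in A, flip i is in A, or neither,   *)
(* the condition reads v(i) > v(j).                                           *)
Definition over i j A :=
  (i \in A) && (j \notin A) || (flip j \in A) && (flip i \notin A).

Definition halfset m i j := [set A in admissible m | over i j A].

(** The pairs [(i, j)] and [(flip j, flip i)] name the same root. *)
Lemma overC i j A : over (flip j) (flip i) A = over i j A.
Proof. by rewrite /over !flipK orbC. Qed.

Lemma halfsetC m i j : halfset m (flip j) (flip i) = halfset m i j.
Proof. by apply/setP => A; rewrite !inE overC. Qed.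

Lemma over_flip i A : isotropic A -> over i (flip i) A = (i \in A).
Proof.
move/isotropicP=> isoA; rewrite /over flipK orbb.
by case: (boolP (i \in A)) => //= /isoA.
Qed.

Lemma over_asym i j A : isotropic A -> over i j A -> ~~ over j i A.
Proof.
move/isotropicP=> isoA; rewrite /over.
have := isoA i; have := isoA j; have := isoA (flip i); have := isoA (flip j).
rewrite !flipK.
by case: (i \in A); case: (j \in A); case: (flip i \in A); case: (flip j \in A) => // *;
  intuition.
Qed.

Lemma mem_halfset m i j A :
  (A \in halfset m i j) = (A \in admissible m) && over i j A.
Proof. by rewrite inE. Qed.

(** * Half-sets in the range 1 < m < n *)

Section Generic.
Variables (m : nat).
Hypotheses (m_gt1 : 1 < m) (m_ltn : m < n).

Let ex2 (x y z w : idx) : y != flip x -> z \notin [set x; y] ->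
  w \notin [set x; y] ->
  exists A, [/\ A \in admissible m, x \in A, y \in A, z \notin A & w \notin A].
Proof.
move=> xy zX wX.
have [||A [mA /subsetP XA zA wA]] :=
    @ex_admissible m [set x; y] z w (isotropic2 xy) _ (ltnW m_ltn) zX wX.
- by rewrite cards2; case: (x != y); lia.
- by rewrite m_ltn orbT.
by exists A; split=> //; apply: XA; rewrite !inE eqxx ?orbT.
Qed.

Lemma halfset_disjoint a b c d :
  a != b -> c != d -> [disjoint halfset m a b & halfset m c d] ->
  (* At least two of the four equalities hold. *)
  let: P := a == d in let: Q := b == c in
  let: R := a == flip c in let: T := b == flip d in
  [|| P && Q, P && R, P && T, Q && R, Q && T | R && T].
Proof.
move=> ab cd /pred0P dis.
have noA A : A \in admissible m -> over a b A -> over c d A = false.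
  move=> mA abA; move: (dis A); rewrite /= !mem_halfset mA abA /=.
  by [].
  (* If [(x, z)] and [(y, w)] name the two roots, a set containing [x], [y] and missing [z], [w]
     lies in both half-sets, so one of the three equalities must obstruct it. Each root has two
     names; the four combinations say that any three of [P], [Q], [R], [T] include a true one. *)
  have key x y z w : over x z =1 over a b -> over y w =1 over c d ->
      x != z -> y != w -> [|| y == flip x, x == w | y == z].
    move=> e1 e2 xz yw; apply: contraT; rewrite !negb_or => /and3P[yx xw yz].
    have [||| A [mA xA yA zA wA]] := @ex2 x y z w => //.
    - by rewrite !inE negb_or eq_sym xz eq_sym yz.
    - by rewrite !inE negb_or eq_sym xw eq_sym yw.
    have := noA A mA; rewrite -e1 -e2 /over xA yA zA wA /= => /(_ isT).
    by [].
  have fab : flip b != flip a by rewrite (inj_eq flip_inj) eq_sym.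
  have fcd : flip d != flip c by rewrite (inj_eq flip_inj) eq_sym.
  have := key a c b d (frefl _) (frefl _) ab cd.
  have := key a _ b _ (frefl _) (overC c d) ab fcd.
  have := key _ c _ d (overC a b) (frefl _) fab cd.
  have := key _ _ _ _ (overC a b) (overC c d) fab fcd.
  rewrite !flipK !(inj_eq flip_inj) ![flip _ == _]eq_flip ?flipK.
  rewrite ![c == _]eq_sym ![d == _]eq_sym.
  rewrite (eq_flip b d) (eq_flip a c).
  do 4!case: (_ == _) => //=.
Qed.

(** Containment makes the first half-set disjoint from that of the opposite root [(d, c)]. Of the
    six cases of [halfset_disjoint], the four mixed ones either collapse to the claim or are refuted
    by an explicit set. *)
Lemma halfset_sub a b c d :
  a != b -> c != d -> halfset m a b \subset halfset m c d ->
  (c, d) = (a, b) \/ (c, d) = (flip b, flip a).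
Proof.
move=> ab cd /subsetP sub.
have dc : d != c by rewrite eq_sym.
have hal A : A \in admissible m -> over a b A -> over c d A.
  by move=> mA abA; have := sub A; rewrite !mem_halfset mA abA /= => /(_ isT).
have ex1 x z w : z != x -> w != x -> exists A,
    [/\ A \in admissible m, x \in A, z \notin A & w \notin A].
  move=> zx wx; case: (@ex2 x x z w); rewrite ?inE ?orbb //.
    by rewrite eq_sym flip_neq.
  by move=> A [mA xA _ zA wA]; exists A.
have dis : [disjoint halfset m a b & halfset m d c].
  apply/pred0P => A; rewrite /= !mem_halfset.
  apply/negP => /andP[/andP[mA abA] /andP[_]]; apply/negP.
  by apply: over_asym (hal A mA abA); case/admissibleP: mA.
have := halfset_disjoint ab dc dis.
have sepF A : A \in admissible m -> over a b A -> ~~ over c d A -> False.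
  by move=> mA abA /negP; apply; exact: hal.
have notin A x : A \in admissible m -> x \in A -> flip x \notin A.
  by case/admissibleP=> /isotropicP isoA _ /isoA.
case/or4P => [/andP[/eqP -> /eqP ->]|/andP[/eqP ac /eqP ad]|
  /andP[/eqP ac /eqP bc]|]; first by left.
- subst c; have [fba|fba] := eqVneq b (flip a).
    by left; rewrite fba ad flipK.
  have [||A [mA bA aA faA]] := ex1 (flip b) a (flip a).
  - by rewrite -eq_flip eq_sym.
  - by rewrite (inj_eq flip_inj).
  case: (sepF A mA); first by rewrite /over bA faA orbT.
  by rewrite /over -ad (negPf aA).
- subst c b; have [da|da] := eqVneq d (flip a); first by left; rewrite da.
  have [||A [mA aA dA _ _]] := @ex2 a d (flip a) (flip a) da.
  1,2: by rewrite !inE negb_or flip_neq eq_sym.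
  case: (sepF A mA); first by rewrite /over aA notin.
  by rewrite /over dA andbF (negPf (notin _ _ mA dA)).
case/or3P=> /andP[/eqP e1 /eqP e2].
- subst d; have {}e2 : b = flip a by rewrite e2 flipK.
  subst b; have [ca|ca] := eqVneq c a; first by left; rewrite ca.
  have [|||A [mA aA cA _ _]] := @ex2 a (flip c) (flip a) (flip a).
  - by rewrite (inj_eq flip_inj).
  1,2: by rewrite !inE negb_or flip_neq (inj_eq flip_inj) eq_sym.
  case: (sepF A mA); first by rewrite /over aA notin.
  rewrite /over cA andbF orbF -[c]flipK.
  by rewrite (negPf (notin _ _ mA cA)).
- subst d; have {}e2 : c = flip b by rewrite e2 flipK.
  subst c; have [fba|fba] := eqVneq a (flip b); first by left; rewrite fba.
  have [||A [mA aA bA fbA]] := ex1 a b (flip b); rewrite ?(eq_sym b) //.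
    by rewrite eq_sym.
  case: (sepF A mA); first by rewrite /over aA bA.
  by rewrite /over !flipK (negPf fbA).
- by right; rewrite e1 e2 !flipK.
Qed.

End Generic.

Definition neighbours A B := [exists i in A, B == flip i |: A :\ i].

Lemma neighboursP A B :
  reflect (exists2 i, i \in A & B = flip i |: A :\ i) (neighbours A B).
Proof. by apply: (iffP exists_inP) => -[i iA /eqP]; exists i => //; apply/eqP. Qed.

Lemma halfset_flip m i :
  halfset m i (flip i) = [set A in admissible m | i \in A].
Proof.
apply/setP => A; rewrite !inE; case: (boolP (isotropic A)) => //= isoA.
by rewrite over_flip.
Qed.

Lemma halfset_neq0 m i j : 0 < m <= n -> i != j -> halfset m i j != set0.
Proof.
case/andP=> m_gt0 mn ij.
have [|||| A [mA /subsetP iA jA _]] :=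
    @ex_admissible m [set i] j j (isotropic1 i) _ mn.
- by rewrite cards1.
- by rewrite inE eq_sym.
- by rewrite inE eq_sym.
- by rewrite eq_sym flip_neq.
by apply/set0Pn; exists A; rewrite mem_halfset mA /over jA iA ?inE.
Qed.

(** * Permutations compatible with half-sets *)

Section Rigidity.
Variables (m : nat) (phi : {set idx} -> {set idx}).
Hypothesis phi_inj : injective phi.
Hypothesis phi_adm : forall A, A \in admissible m -> phi A \in admissible m.
Hypothesis phi_half : forall i j, i != j ->
  exists k l, k != l /\ halfset m k l \subset phi @: halfset m i j.

(* Here all half-sets are minimal. Those of the long roots (i, flip i) are    *)
(* disjoint from at least four others, those of the short roots from only     *)
(* three; so phi permutes the sets of all A containing a given i.             *)
Lemma neighbours_generic A B : 1 < m < n ->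
  A \in admissible m -> neighbours A B -> neighbours (phi A) (phi B).
Proof.
case/andP=> m_gt1 m_ltn; have n_gt2 : 1 < n.-1 by lia.
have sub := halfset_sub m_gt1 m_ltn; have dis := halfset_disjoint m_gt1 m_ltn.
pose C := [set halfset m p.1 p.2 | p : idx * idx & p.1 != p.2].
have CP (D : {set {set idx}}) :
    reflect (exists i j, i != j /\ D = halfset m i j) (D \in C).
  apply: (iffP imsetP) => [[[i j]]|[i [j [ij ->]]]].
    by rewrite inE /= => ij ->; exists i, j.
  by exists (i, j); rewrite ?inE.
have phiC (D : {set {set idx}}) : D \in C -> phi @: D \in C.
  apply: antichain_imset => // [D1 D2|D1].
    case/CP=> i [j [ij ->]] /CP[k [l [kl ->]]] /(sub _ _ _ _ ij kl).
    by case=> [[-> ->]//|[-> ->]]; rewrite halfsetC.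
  case/CP=> i [j [/phi_half [k [l [kl kl_sub]]] ->]].
  by exists (halfset m k l) => //; apply/CP; exists k, l.
have imI (D E : {set {set idx}}) : [disjoint D & E] ->
    [disjoint phi @: D & phi @: E].
  by rewrite imset_disjoint // => x y _ _; exact: phi_inj.
have star_dis a x : [disjoint halfset m a (flip a) & halfset m (flip a) x].
  apply/pred0P => X; rewrite /= halfset_flip !inE.
  apply/negP => /andP[/andP[/andP[/isotropicP isoX _] aX] /andP[_]].
  by rewrite /over (negPf (isoX _ aX)) flipK aX andbF.
have nf i : i != flip i by rewrite eq_sym flip_neq.
have long i : exists a, phi @: halfset m i (flip i) = halfset m a (flip a).
  have /CP[a [b [ab ab_def]]] : phi @: halfset m i (flip i) \in C.
    by apply: phiC; apply/CP; exists i, (flip i).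
  have [ba|ba] := eqVneq b (flip a); first by exists a; rewrite ab_def ba.
  have /card_gt1P[k [l [ki li kl]]] : 1 < #|[set~ i.1]|.
    by rewrite cardsC1 card_ord.
  move: ki li; rewrite !inE => ki li.
  (* Were the image the half-set of a short root [(a, b)], these four half-sets, disjoint from that
     of [(i, flip i)], would have images among the three in [sub3]: the opposite root and two long
     ones. *)
  pose s := [:: (flip i, i); (flip i, (k, false)); (flip i, (k, true));
                (flip i, (l, false))].
  have s_neq p : p \in s -> p.1 != p.2 /\ p.1 = flip i.
    have ne t c : t != i.1 -> flip i != (t, c).
      by rewrite /flip xpair_eqE eq_sym => /negPf->.
    rewrite !inE => /or4P[] /eqP ->; split=> //=; rewrite ?flip_neq //.
    - exact: ne.
    - exact: ne.
    - exact: ne.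
  have uniq_s : uniq [seq phi @: halfset m p.1 p.2 | p <- s].
    rewrite map_inj_in_uniq.
      rewrite /= !inE !xpair_eqE eqxx /= (negPf kl) eqxx andbF /=.
      have nei t c : t != i.1 -> (i == (t, c)) = false.
        by rewrite [i]surjective_pairing xpair_eqE eq_sym => /negPf->.
      by rewrite !nei.
    case=> [p1 p2] [q1 q2] /s_neq[/= p12 p1i] /s_neq[/= q12 q1i].
    move/(imset_inj phi_inj) => pq.
    have [|[<- <-]//|] := sub _ _ _ _ p12 q12; first by rewrite pq.
    case=> q1p q2p; have p2i : p2 = i by apply: flip_inj; rewrite -q1p.
    by rewrite q2p q1i p1i p2i flipK.
  have sub3 : {subset [seq phi @: halfset m p.1 p.2 | p <- s] <=
      [:: halfset m b a; halfset m (flip a) a; halfset m b (flip b)]}.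
    move=> _ /mapP[p ps ->]; have [p12 p1] := s_neq _ ps.
    have /CP[c [d [cd cd_def]]] : phi @: halfset m p.1 p.2 \in C.
      by apply: phiC; apply/CP; exists p.1, p.2.
    have := dis _ _ _ _ ab cd; rewrite -ab_def -cd_def.
    have -> : [disjoint phi @: halfset m i (flip i) &
                        phi @: halfset m p.1 p.2].
      by apply: imI; rewrite p1; exact: star_dis.
    move/(_ isT); rewrite cd_def !inE.
    case/or4P => [/andP[/eqP <- /eqP <-]|/andP[/eqP <- /eqP e2]|
      /andP[/eqP e1 /eqP e2]|]; first by rewrite eqxx.
    - by rewrite e2 flipK eqxx orbT.
    - by move: ba; rewrite e2 e1 eqxx.
    case/or3P=> /andP[/eqP e1 /eqP e2].
    - by move: ba; rewrite e2 flipK e1 eqxx.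
    - by rewrite -e1 -[d]flipK -e2 eqxx !orbT.
    by rewrite -[c]flipK -e1 -[d]flipK -e2 halfsetC eqxx.
  by have := uniq_leq_size uniq_s sub3; rewrite size_map.
have [pi piP] : exists pi : idx -> idx, forall i,
    phi @: halfset m i (flip i) = halfset m (pi i) (flip (pi i)).
  have longb i : exists a,
      phi @: halfset m i (flip i) == halfset m a (flip a).
    by have [a ->] := long i; exists a.
  by exists (fun i => xchoose (longb i)) => i; exact/eqP/(xchooseP (longb i)).
have mem_pi i X : X \in admissible m -> (pi i \in phi X) = (i \in X).
  move=> mX; have : (phi X \in phi @: halfset m i (flip i)) = (i \in X).
    by rewrite mem_imset // halfset_flip inE mX.
  by rewrite piP halfset_flip inE phi_adm.
have pi_inj : injective pi.
  move=> i j pij; have /(imset_inj phi_inj) ij :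
      phi @: halfset m i (flip i) = phi @: halfset m j (flip j).
    by rewrite !piP pij.
  have [|[->]//|[-> _]] := sub i (flip i) j (flip j) (nf i) (nf j).
    by rewrite ij.
  by rewrite flipK.
(* Two disjoint long half-sets belong to opposite indices. *)
have pi_flip i : pi (flip i) = flip (pi i).
  have := dis _ _ _ _ (nf (pi i)) (nf (pi (flip i))).
  rewrite -!piP imI => [/(_ isT)|]; last exact: star_dis.
  rewrite flipK (eq_flip (pi i)) !andbb !orbb => /eqP ->.
  by rewrite flipK.
have phiE X : X \in admissible m -> phi X = pi @: X.
  move=> mX; apply/esym/eqP; rewrite eqEcard card_imset //.
  have [[_ ->] [_ ->]] := (admissibleP _ _ mX, admissibleP _ _ (phi_adm mX)).
  rewrite leqnn andbT; apply/subsetP => _ /imsetP[i iX ->].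
  by rewrite mem_pi.
move=> mA /neighboursP[i iA defB].
have mB : B \in admissible m.
  have [isoA cA] := admissibleP _ _ mA.
  apply/admissibleP; rewrite defB; split.
    apply: isotropicU1; last by rewrite flipK !inE eqxx.
    by apply: isotropicS isoA; apply: subsetDl.
  rewrite cardsU1 !inE (negPf ((isotropicP _ isoA) _ iA)) andbF /= -cA.
  by rewrite (cardsD1 i A) iA.
have imD1 : pi @: (A :\ i) = pi @: A :\ pi i.
  apply/setP => y; rewrite !inE; apply/imsetP/andP => [[x]|[yi /imsetP[x xA defy]]].
    by rewrite !inE => /andP[xi xA] ->; rewrite (inj_eq pi_inj) xi imset_f.
  by exists x; rewrite // !inE xA andbT; apply: contraNneq yi => <-; rewrite defy.
apply/neighboursP; exists (pi i); first by rewrite mem_pi.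
by rewrite !phiE // defB imsetU1 pi_flip imD1.
Qed.

Lemma admissible_full A i : A \in admissible n -> (flip i \in A) = (i \notin A).
Proof.
case/admissibleP=> isoA cA; case: (boolP (i \in A)) => iA /=.
  by apply/negbTE/(isotropicP _ isoA).
have : A :|: flips A == setT.
  by rewrite eqEcard subsetT cardsT card_idx isotropic_cardU // cA leqnn.
by move/eqP/setP/(_ i); rewrite !inE (negPf iA) /= => ->.
Qed.

Lemma full_neighbours A B :
  A \in admissible n -> B \in admissible n -> #|A :&: B| = n.-1 -> 0 < n ->
  neighbours A B.
Proof.
move=> nA nB cAB n_gt0; have [[_ cA] [_ cB]] := (admissibleP _ _ nA, admissibleP _ _ nB).
have /subsetPn[i iA iB] : ~~ (A \subset B).
  by apply/negP => /setIidPl AB; move: cAB; rewrite AB cA; lia.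
apply/neighboursP; exists i => //; apply/esym/eqP; rewrite eqEcard.
have ABsub : A :&: B \subset A :\ i.
  apply/subsetP => x; rewrite !inE => /andP[xA xB]; rewrite xA andbT.
  by apply: contraNneq iB => <-.
have cAi : #|A :\ i| = n.-1 by have := cardsD1 i A; rewrite iA cA; lia.
have defAi : A :&: B = A :\ i by apply/eqP; rewrite eqEcard ABsub cAB cAi leqnn.
rewrite cB cardsU1 !inE (admissible_full _ nA) iA andbF /= cAi.
rewrite add1n prednK // leqnn andbT subUset sub1set admissible_full // iB.
by rewrite -defAi subsetIr.
Qed.

(* Now the minimal half-sets consist of the A containing a given pair; phi    *)
(* permutes them, and A :&: B can be measured by counting pairs.              *)
Lemma neighbours_full A B : m = n -> 2 < n ->
  A \in admissible m -> B \in admissible m ->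
  neighbours A B -> neighbours (phi A) (phi B).
Proof.
move=> mn n_gt2 mA mB /neighboursP[i iA defB].
have m_n Y : Y \in admissible m -> Y \in admissible n by rewrite mn.
pose M (p : {set idx}) := [set X in admissible m | p \subset X].
pose C := [set M p | p in admissible 2].
have M_inj p q : p \in admissible 2 -> q \in admissible 2 ->
    M p \subset M q -> p = q.
  move=> /admissibleP[isop cp] /admissibleP[_ cq] /subsetP Mpq.
  apply/esym/eqP; rewrite eqEcard cp cq leqnn andbT.
  apply/subsetP => x xq; apply: contraT => xp.
  have [|||||X [mX pX xX _]] := @ex_admissible m p x x isop.
  - by rewrite cp; lia.
  - by rewrite mn.
  - exact: xp.
  - exact: xp.
  - by rewrite eq_sym flip_neq.
  have : X \in M q by apply: Mpq; rewrite inE mX.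
  by rewrite inE mX => /subsetP/(_ x xq) xX'; rewrite xX' in xX.
have pair2 k l : k != l -> l != flip k -> [set k; l] \in admissible 2.
  by move=> kl lk; apply/admissibleP; rewrite isotropic2 // cards2 kl.
have half_pair k l : k != l -> l != flip k ->
    halfset m k (flip l) = M [set k; l].
  move=> kl lk; apply/setP => X; rewrite !in_set subUset !sub1set.
  case: (boolP (isotropic X && _)) => //= mX.
  have nX : X \in admissible n by apply: m_n; rewrite inE.
  by rewrite /over flipK !(admissible_full _ nX) !negbK [(l \in X) && _]andbC orbb.
have phiC (D : {set {set idx}}) : D \in C -> phi @: D \in C.
  apply: antichain_imset => // [D1 D2|D1].
    by move=> /imsetP[p p2 ->] /imsetP[q q2 ->] /M_inj->.
  case/imsetP=> p /admissibleP[isop cp] ->.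
  have /cards2P[a [b [ab defp]]] : #|p| == 2 by rewrite cp.
  have ba : b != flip a.
    apply: contraTneq isop => ba; apply/isotropicP => /(_ a).
    by rewrite defp ba !inE !eqxx orbT => /(_ isT).
  have [|k [l [kl kl_sub]]] := @phi_half a (flip b).
    by rewrite eq_flipC.
  rewrite half_pair // -defp in kl_sub.
  suff [q q2 qkl] : exists2 q, q \in admissible 2 & M q \subset halfset m k l.
    by exists (M q); [apply: imset_f | apply: subset_trans kl_sub].
  (* A long half-set consists of all [X] containing [k], so it contains [M] of any pair through
     [k]. *)
  have [lk|lk] := eqVneq l (flip k).
    have [x xk] : exists x : 'I_n, x != k.1.
      have : 0 < #|[set~ k.1]| by rewrite cardsC1 card_ord; lia.
      by case/card_gt0P=> x; rewrite !inE; exists x.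
    exists [set k; (x, false)].
      apply: pair2; last by rewrite xpair_eqE (negPf xk).
      by rewrite eq_sym [k]surjective_pairing xpair_eqE (negPf xk).
    apply/subsetP => X; rewrite lk halfset_flip !in_set subUset !sub1set.
    by case/andP=> -> /andP[].
  have flk : flip l != k by rewrite eq_flip.
  have fl_fk : flip l != flip k by rewrite (inj_eq flip_inj) eq_sym.
  exists [set k; flip l]; first by apply: pair2; rewrite // eq_sym.
  by rewrite -half_pair ?flipK // eq_sym.
have [psi psiP] : exists psi : {set idx} -> {set idx}, forall p,
    p \in admissible 2 -> psi p \in admissible 2 /\ phi @: M p = M (psi p).
  have ex_q p : exists q, (p \in admissible 2) ==>
      (q \in admissible 2) && (phi @: M p == M q).
    have [p2|_] /= := boolP (p \in admissible 2); last by exists p.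
    have /imsetP[q q2 ->] : phi @: M p \in C by apply/phiC/imset_f.
    by exists q; rewrite q2 eqxx.
  exists (fun p => xchoose (ex_q p)) => p p2.
  by have /implyP/(_ p2)/andP[-> /eqP] := xchooseP (ex_q p).
have psi_inj : {in admissible 2 &, injective psi}.
  move=> p q p2 q2 pq; apply: M_inj => //.
  have /(imset_inj phi_inj) -> // : phi @: M p = phi @: M q.
  by rewrite (psiP p p2).2 (psiP q q2).2 pq.
have [[[isoA cA] nA] nB] := (admissibleP _ _ mA, m_n _ mA, m_n _ mB).
have nphiA := m_n _ (phi_adm mA); have nphiB := m_n _ (phi_adm mB).
apply: full_neighbours => //; last by lia.
have cAi : #|A :\ i| = n.-1 by have := cardsD1 i A; rewrite iA cA; lia.
pose S := phi A :&: phi B.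
have S_lt : #|S| < n.
  suff : S \proper phi A by move/proper_card; rewrite (admissibleP _ _ nphiA).2.
  rewrite properEneq subsetIl andbT.
  apply/eqP => /setIidPl AB.
  have /phi_inj eqAB : phi A = phi B.
    apply/eqP; rewrite eqEcard AB.
    by rewrite (admissibleP _ _ nphiA).2 (admissibleP _ _ nphiB).2 leqnn.
  move: iA; rewrite eqAB defB !inE eqxx /= orbF eq_sym flip_neq //.
pose pairs (X : {set idx}) := [set p : {set idx} | p \subset X & #|p| == 2].
have Ai_adm p : p \in pairs (A :\ i) -> p \in admissible 2.
  rewrite !inE => /andP[pA ->]; rewrite andbT.
  by apply: isotropicS isoA; apply: subset_trans pA (subsetDl _ _).
have pairsS : psi @: pairs (A :\ i) \subset pairs S.
  apply/subsetP => _ /imsetP[p pAi ->]; have p2 := Ai_adm _ pAi.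
  have [/admissibleP[_ cpsi] phiM] := psiP p p2.
  move: pAi; rewrite [p \in _]inE => /andP[pAi _].
  rewrite inE cpsi eqxx andbT subsetI.
  have psiX X : X \in admissible m -> A :\ i \subset X -> psi p \subset phi X.
    move=> mX AX; have : phi X \in M (psi p).
      by rewrite -phiM imset_f // inE mX (subset_trans pAi).
    by rewrite inE => /andP[].
  by rewrite !psiX ?subsetDl // defB subsetUr.
(* Pairs inside [A :\ i] inject into pairs inside [S]. Comparing binomials forces [S] to have at
   least [n.-1] elements, since [n > 2]. *)
have := subset_leq_card pairsS; rewrite card_in_imset; last first.
  by move=> p q /Ai_adm p2 /Ai_adm q2; exact: psi_inj.
rewrite !cards_draws cAi => bin_le.
suff : n.-2 < #|S| by move: S_lt; rewrite -/S; clear -n_gt2; lia.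
rewrite ltnNge; apply/negP => S_le.
have bin_le' : 'C(#|S|, 2) <= 'C(n.-2, 2) by exact: leq_bin2l.
have := leq_trans bin_le bin_le'.
have -> : 'C(n.-1, 2) = 'C(n.-2, 2) + n.-2.
  by rewrite -{2}[n.-2]bin1 -binS; congr binomial; lia.
by lia.
Qed.

(** Such singleton half-sets occur for long roots when [m = 1] and for short roots when
    [n = m = 2]. *)
Hypothesis phi_flips : forall i j A, i != j ->
  halfset m i j = [set A] -> halfset m j i = [set flips A] ->
  phi (flips A) = flips (phi A).

(** Neighbouring singletons are opposite, and [phi_flips] preserves opposites. *)
Lemma neighbours1 A B : m = 1 ->
  A \in admissible m -> neighbours A B -> neighbours (phi A) (phi B).
Proof.
move=> m1 mA /neighboursP[i iA ->].
have cards1_adm X : X \in admissible m -> #|X| == 1.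
  by rewrite m1 => /admissibleP[_ ->].
have /cards1P[j defA] := cards1_adm _ mA.
move: iA; rewrite defA => /set1P->{i}.
have hs k : halfset m k (flip k) = [set [set k]].
  apply/setP => X; rewrite halfset_flip in_set in_set1.
  apply/andP/eqP => [[/cards1_adm/cards1P[x ->] /set1P ->] // | ->].
  rewrite in_set1 eqxx; split=> //; apply/admissibleP.
  by rewrite isotropic1 cards1 m1.
have flips1 : flips [set j] = [set flip j].
  by apply/setP => k; rewrite !inE eq_flip.
have -> : flip j |: [set j] :\ j = flips [set j].
  by rewrite setDv setU0 flips1.
rewrite (@phi_flips j (flip j)) //; first last.
- by rewrite -{2}[j]flipK hs flips1.
- by rewrite eq_sym flip_neq.
rewrite defA in mA; have mphi := phi_adm mA.
have /cards1P[k ->] := cards1_adm _ mphi.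
apply/neighboursP; exists k; rewrite ?inE // setDv setU0.
by apply/setP => x; rewrite !inE eq_flip.
Qed.

(** For [n = 2] the neighbours of [A] are the full sets other than [A] and [flips A]; [phi] is
    injective and respects both exclusions. *)
Lemma neighbours2 A B : m = n -> n = 2 ->
  A \in admissible m -> B \in admissible m ->
  neighbours A B -> neighbours (phi A) (phi B).
Proof.
move=> mn n2 mA mB /neighboursP[i iA defB].
have m_n Y : Y \in admissible m -> Y \in admissible n by rewrite mn.
have [nA nB] := (m_n _ mA, m_n _ mB).
have card2 X : X \in admissible n -> #|X| = 2.
  by rewrite -n2 => /admissibleP[].
have [isoA _] := admissibleP _ _ nA.
have [k defA] : exists k, A :\ i = [set k].
  by apply/cards1P; have := cardsD1 i A; rewrite iA (card2 _ nA) add1n => -[<-].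
have [ki kA] : k != i /\ k \in A.
  by have := set11 k; rewrite -defA !inE => /andP[].
have kfi : k != flip i.
  by apply: contraTneq kA => ->; apply: (isotropicP _ isoA).
have ifk : i != flip k by rewrite eq_flipC.
have pairE : A = [set i; k].
  by rewrite -(setD1K iA) defA.
have hs x y X : x != y -> x \in X -> y \in X -> X \in admissible n ->
    halfset m x (flip y) = [set X].
  move=> xy xX yX nX; apply/setP => Y; rewrite mem_halfset in_set1.
  have XE : X = [set x; y].
    apply/esym/eqP; rewrite eqEcard cards2 xy card2 // leqnn andbT.
    by rewrite subUset !sub1set xX yX.
  apply/andP/eqP => [[mY]|->]; last first.
    split; last by rewrite /over xX admissible_full // yX.
    by rewrite mn.
  have nY := m_n _ mY.
  rewrite /over flipK !(admissible_full _ nY) !negbK [(y \in Y) && _]andbC orbb.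
  case/andP=> xY yY; apply/esym/eqP; rewrite eqEcard !card2 // leqnn andbT.
  by rewrite XE subUset !sub1set xY yY.
have phi_flipsA : phi (flips A) = flips (phi A).
  apply: (@phi_flips i (flip k) A ifk).
    by apply: hs; rewrite // eq_sym.
  rewrite -[i in LHS]flipK; apply: hs; rewrite ?mem_flips ?flipK //.
    by rewrite (inj_eq flip_inj).
  exact: admissible_flips.
have [nphiA nphiB] := (m_n _ (phi_adm mA), m_n _ (phi_adm mB)).
apply: full_neighbours => //; last by rewrite n2.
have AB : phi A != phi B.
  apply/negP => /eqP/phi_inj eqAB.
  by move: iA; rewrite eqAB defB !inE eqxx /= orbF eq_sym flip_neq.
have fAB : flips (phi A) != phi B.
  rewrite -phi_flipsA; apply/negP => /eqP/phi_inj/setP/(_ k).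
  by rewrite defB mem_flips !inE admissible_full // kA ki orbT.
have : #|phi A :&: phi B| < 2.
  suff : phi A :&: phi B \proper phi A by move/proper_card; rewrite (card2 _ nphiA).
  rewrite properEneq subsetIl andbT.
  apply: contraNneq AB => /setIidPl AB.
  by rewrite eqEcard AB (card2 _ nphiA) (card2 _ nphiB).
have : 0 < #|phi A :&: phi B|.
  rewrite card_gt0; apply: contraNneq fAB => AB0.
  rewrite eqEcard card_flips !card2 // leqnn andbT.
  apply/subsetP => x; rewrite mem_flips => fxA; apply: contraT => xB.
  have : flip x \in phi A :&: phi B by rewrite inE fxA admissible_full.
  by rewrite AB0 inE.
by move: (#|_|) => c; rewrite n2; lia.
Qed.

Lemma phi_neighbours A B : 0 < m <= n ->
  A \in admissible m -> B \in admissible m ->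
  neighbours A B -> neighbours (phi A) (phi B).
Proof.
case/andP=> m_gt0 mn mA mB.
have [m1|m_neq1] := eqVneq m 1; first exact: neighbours1.
have [m_ltn|n_lem] := ltnP m n; first by apply: neighbours_generic => //; lia.
have eq_mn : m = n by lia.
have [n_gt2|n_le2] := ltnP 2 n; first exact: neighbours_full.
by apply: neighbours2 => //; lia.
Qed.

(** An injection of the finite set of neighbouring pairs into itself is onto, so [phi_neighbours]
    can be reversed. *)
Lemma phi_neighboursE A B : 0 < m <= n ->
  A \in admissible m -> B \in admissible m ->
  neighbours (phi A) (phi B) = neighbours A B.
Proof.
move=> mn mA mB; apply/idP/idP; last exact: phi_neighbours.
pose P := [set p : {set idx} * {set idx} |
  [&& p.1 \in admissible m, p.2 \in admissible m & neighbours p.1 p.2]].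
have inP p : (p \in P) =
    [&& p.1 \in admissible m, p.2 \in admissible m & neighbours p.1 p.2].
  by rewrite inE.
pose phi2 (p : {set idx} * {set idx}) := (phi p.1, phi p.2).
have phi2_inj : injective phi2 by move=> [A1 B1] [A2 B2] [/phi_inj-> /phi_inj->].
have phi2P : phi2 @: P = P.
  apply/eqP; rewrite eqEcard card_imset // leqnn andbT.
  apply/subsetP => _ /imsetP[[A1 B1] /[!inP] /and3P[mA1 mB1 AB1] ->].
  by rewrite /= !phi_adm //= phi_neighbours.
move=> AB; have : phi2 (A, B) \in phi2 @: P by rewrite phi2P inP /= !phi_adm.
by rewrite mem_imset // inP => /and3P[].
Qed.
End Rigidity.

Lemma ex_fresh m A : A \in admissible m -> m < n ->
  exists2 i, i \notin A & flip i \notin A.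
Proof.
case/admissibleP=> isoA cA mn.
have /subsetPn[i _ iA] : ~~ (setT \subset A :|: flips A).
  apply/negP => /subset_leq_card.
  by rewrite cardsT card_idx isotropic_cardU // cA leq_double leqNgt mn.
by move: iA; rewrite !inE negb_or => /andP[]; exists i.
Qed.

Lemma admissibleU1 m A i : A \in admissible m -> i \notin A -> flip i \notin A ->
  i |: A \in admissible m.+1.
Proof.
case/admissibleP=> isoA cA iA fA; apply/admissibleP.
by rewrite isotropicU1 // cardsU1 iA cA.
Qed.

Lemma admissibleD1 m A i : A \in admissible m.+1 -> i \in A ->
  A :\ i \in admissible m.
Proof.
case/admissibleP=> isoA cA iA; apply/admissibleP; split.
  by apply: isotropicS isoA; exact: subsetDl.
by apply: succn_inj; rewrite -cA (cardsD1 i A) iA.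
Qed.

Lemma neighboursU1 A i : i \notin A -> flip i \notin A ->
  neighbours (i |: A) (flip i |: A).
Proof.
move=> iA fA; apply/neighboursP; exists i; first exact: setU11.
by rewrite setU1K.
Qed.

Lemma capU1_flip A i : i \notin A -> flip i \notin A ->
  (i |: A) :&: (flip i |: A) = A.
Proof.
move=> iA fA; apply/setP => x; rewrite !inE.
have [->|xi] := eqVneq x i; first by rewrite (negPf iA) eq_sym flip_neq.
by case: (x \in A) => //=; rewrite orbT.
Qed.
End SignedSets.

(** * Symplectic frames *)

Local Open Scope ring_scope.

Section Symplectic.
Variables (n : nat) (F : fieldType) (V : vectType F).
Hypothesis dimV : \dim {:V} = (2 * n)%N.
Variable Omega : {skew_symmetric V}.
Hypothesis sympO : is_psymplectic Omega.
Implicit Types (u v w x y : V) (U W S T : {vspace V}).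
Local Notation idx := (idx n).
Implicit Types (i j k : idx) (A B J : {set idx}) (e : idx -> V).
Local Notation "''[' u , v ]" := (Omega u%R v%R) : ring_scope.
Local Notation perp := (orthov Omega).

(** In characteristic 2 this is part of being symplectic; otherwise skew symmetry makes twice the
    value zero. *)
Lemma form_alt u : '[u, u] = 0.
Proof.
have [_ _ alt2] := sympO; have [/alt2-> //|n2] := boolP (2 \in [pchar F]).
have : '[u, u] *+ 2 = 0.
  by rewrite mulr2n {1}hermC expr1 mulN1r addNr.
move/eqP; rewrite -mulr_natr mulf_eq0 => /orP[/eqP //|/eqP two0].
by move: n2; rewrite inE /= two0 eqxx.
Qed.

Lemma formC u v : '[u, v] = - '[v, u].
Proof. by rewrite hermC expr1 mulN1r. Qed.

Lemma form_eq0C u v : ('[u, v] == 0) = ('[v, u] == 0).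
Proof. exact: herm_eq0C. Qed.

Lemma formDl u v w : '[u + v, w] = '[u, w] + '[v, w].
Proof. by rewrite linearDl. Qed.

Lemma formDr u v w : '[w, u + v] = '[w, u] + '[w, v].
Proof. by rewrite linearDr. Qed.

Lemma formZl a u w : '[a *: u, w] = a * '[u, w].
Proof. by rewrite linearZl_LR. Qed.

Lemma formZr a u w : '[w, a *: u] = a * '[w, u].
Proof. by rewrite linearZr_LR. Qed.

Lemma mem_perpD U W v : (v \in perp (U + W)) = (v \in perp U) && (v \in perp W).
Proof. exact: orthovD. Qed.

Lemma perpD U W : perp (U + W) = (perp U :&: perp W)%VS.
Proof. by apply/vspaceP => v; rewrite memv_cap mem_perpD. Qed.

Lemma perpS U W : (U <= W)%VS -> (perp W <= perp U)%VS.
Proof.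
move=> /subvP UW; apply/orthovP => x y /mem_orthovP xW /UW; exact: xW.
Qed.

Lemma sub_perp2 U : (U <= perp (perp U))%VS.
Proof. by rewrite orthov_sym. Qed.

Lemma dim_perp_add U W : (\dim (perp U) <= \dim (perp (U + W)) + \dim W)%N.
Proof.
have key (s : seq V) :
    (\dim (perp U) <= \dim (perp (U + <<s>>)) + size s)%N.
  elim: s => [|x s IH] /=; first by rewrite span_nil addv0 addn0.
  rewrite span_cons (addvC <[x]>%VS) addvA perpD; apply: leq_trans IH _.
  have := leq_dim_orthov1 Omega x (perp (U + <<s>>)%VS); lia.
by have := key (vbasis W); rewrite (span_basis (vbasisP W)) size_tuple.
Qed.

(** Enlarging a subspace by [W] lowers the dimension of its orthogonal by at most that of [W]. Going
    from [0] to [U] gives one bound; going from [U] to the whole space, whose orthogonal is zero,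
    gives the other. *)
Lemma dim_perp U : \dim (perp U) = (\dim {:V} - \dim U)%N.
Proof.
have [/eqP rad0 _ _] := sympO.
have := dim_perp_add U U^C%VS; rewrite addv_complf rad0 dimv0 add0n dimv_compl.
have := dim_perp_add 0 U; rewrite add0v orthov0.
have := dimvS (subvf U); have := dimvS (subvf (perp U)); lia.
Qed.

Lemma perpK U : perp (perp U) = U.
Proof.
apply/esym/eqP; rewrite eqEdim sub_perp2 !dim_perp.
have := dimvS (subvf U); lia.
Qed.

Lemma ex_perp_notin U x : x \notin U ->
  exists2 y, y \in perp U & '[x, y] != 0.
Proof. by rewrite -{1}[U]perpK => /mem_orthovPn. Qed.

(** * Coordinate subspaces of a frame *)

(** A symplectic basis up to scalars: values on hyperbolic pairs are only nonzero, since only the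
    points [<[e i]>] matter. *)
Definition frame e := forall i j, ('[e i, e j] != 0) = (j == flip i).

Definition spanf e A : {vspace V} := (\sum_(i in A) <[e i]>)%VS.

Lemma frame_eq0 e i j : frame e -> j != flip i -> '[e i, e j] = 0.
Proof. by move=> fe; rewrite -fe negbK => /eqP. Qed.

Lemma frame_neq0 e i : frame e -> '[e i, e (flip i)] != 0.
Proof. by move=> fe; rewrite fe. Qed.

Lemma mem_frame e A i : i \in A -> e i \in spanf e A.
Proof. by move=> iA; rewrite memvE (sumv_sup i). Qed.

Lemma spanf_subP e A U :
  reflect (forall i, i \in A -> e i \in U) (spanf e A <= U)%VS.
Proof.
apply: (iffP subv_sumP) => h i /h; by rewrite memvE.
Qed.

Lemma spanf_sum e A v : v \in spanf e A ->
  exists c : idx -> F, v = \sum_(i in A) c i *: e i.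
Proof.
case/memv_sumP=> w wP ->.
have cP i : exists c, (i \in A) ==> (w i == c *: e i).
  case: (boolP (i \in A)) => [/wP/vlineP[c ->]|_]; last by exists 0.
  by exists c; rewrite eqxx.
exists (fun i => xchoose (cP i)); apply: eq_bigr => i iA.
by have /implyP/(_ iA)/eqP := xchooseP (cP i).
Qed.

Lemma form_suml e A c v :
  '[\sum_(i in A) c i *: e i, v] = \sum_(i in A) c i * '[e i, v].
Proof.
rewrite -applyrE linear_sum; apply: eq_bigr => i _.
by rewrite /= formZl.
Qed.

Lemma form_sumr e A c v :
  '[v, \sum_(i in A) c i *: e i] = \sum_(i in A) c i * '[v, e i].
Proof.
rewrite formC form_suml -sumrN; apply: eq_bigr => i _.
by rewrite -mulrN -formC.
Qed.

Lemma form_sum_flip e A c j : frame e -> flip j \in A ->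
  '[\sum_(i in A) c i *: e i, e j] = c (flip j) * '[e (flip j), e j].
Proof.
move=> fe jA; rewrite form_suml (bigD1 (flip j)) //= big1 ?addr0 // => i.
case/andP=> _ ij; rewrite (@frame_eq0 e) ?mulr0 //.
by rewrite eq_flipC.
Qed.

Lemma frame_basis e : frame e ->
  basis_of {:V} [seq e i | i : idx].
Proof.
move=> fe; pose X := [tuple of [seq e i | i : idx]].
have freeX : free X.
  apply/freeP => c c0 t; pose c' i := c (enum_rank i).
  have sum0 : \sum_(i in [set: idx]) c' i *: e i = 0.
    transitivity (\sum_(i in {: idx}) c' i *: e i).
      by apply: eq_bigl => i; rewrite inE.
    rewrite -[RHS]c0 big_enum_val.
    apply: eq_bigr => s _; rewrite /c' enum_valK; congr (_ *: _).
    rewrite (nth_map (enum_val s)) -?cardE ?ltn_ord //.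
    by rewrite -enum_val_nth.
  have := @form_sum_flip e setT c' (flip (enum_val t)) fe (in_setT _).
  rewrite sum0 flipK linear0l => /esym/eqP.
  by rewrite mulf_eq0 (negPf (frame_neq0 _ fe)) orbF /c' enum_valK => /eqP.
rewrite basisEfree; apply/and3P; split=> //; first by apply/subvP => v; rewrite memvf.
by rewrite size_map -cardE card_idx dimV mul2n.
Qed.

Lemma frame_full e : frame e -> spanf e setT = fullv.
Proof.
move=> fe; rewrite -(span_basis (frame_basis fe)) span_def big_image /=.
by apply: eq_bigl => i; rewrite inE.
Qed.

(** Up to a nonzero factor, pairing with [e (flip i)] reads off the coordinate at [i]. *)
Lemma mem_spanf e A v : frame e ->
  reflect (forall i, i \notin A -> '[v, e (flip i)] = 0) (v \in spanf e A).
Proof.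
move=> fe; apply: (iffP idP) => [/spanf_sum[c ->] i iA|v0].
  rewrite form_suml big1 // => j jA; rewrite frame_eq0 ?mulr0 //.
  by rewrite (inj_eq (@flip_inj n)); apply: contraNneq iA => ->.
have [c defv] : exists c : idx -> F, v = \sum_(i in [set: idx]) c i *: e i.
  by apply: spanf_sum; rewrite frame_full ?memvf.
rewrite defv; apply: memv_suml => i _.
have [iA|iA] := boolP (i \in A); first by rewrite memvZ ?mem_frame.
have : '[v, e (flip i)] = 0 by apply: v0.
rewrite defv form_sum_flip ?inE // flipK => /eqP.
by rewrite mulf_eq0 (negPf (frame_neq0 _ fe)) orbF => /eqP ->; rewrite scale0r mem0v.
Qed.

Lemma spanf_cap e A B : frame e ->
  (spanf e A :&: spanf e B)%VS = spanf e (A :&: B).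
Proof.
move=> fe; apply/vspaceP => v; rewrite memv_cap.
apply/andP/idP => [[/(mem_spanf _ _ fe) vA /(mem_spanf _ _ fe) vB]|].
  by apply/mem_spanf => // i; rewrite inE negb_and => /orP[/vA|/vB].
move/(mem_spanf _ _ fe) => vAB.
by split; apply/mem_spanf => // i iA; apply: vAB; rewrite inE (negPf iA) ?andbF.
Qed.

Lemma frame_mem e A i : frame e -> (e i \in spanf e A) = (i \in A).
Proof.
move=> fe; apply/idP/idP => [|/mem_frame//]; apply: contraTT => iA.
apply/negP => /(mem_spanf _ _ fe)/(_ i iA) /eqP.
by rewrite (negPf (frame_neq0 _ fe)).
Qed.

Lemma spanfS e A B : frame e -> (spanf e A <= spanf e B)%VS = (A \subset B).
Proof.
move=> fe; apply/spanf_subP/subsetP => AB i iA; last by rewrite mem_frame ?AB.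
by rewrite -(frame_mem _ _ fe) AB.
Qed.

Lemma spanf_inj e : frame e -> injective (spanf e).
Proof.
move=> fe A B AB; apply/eqP; rewrite eqEsubset -!(spanfS _ _ fe).
by rewrite AB subvv.
Qed.

Lemma spanfU e A B : spanf e (A :|: B) = (spanf e A + spanf e B)%VS.
Proof.
apply/eqP; rewrite eqEsubv subv_add; apply/and3P; split; apply/spanf_subP => i.
- rewrite inE => /orP[] iA.
    by apply: (subvP (addvSl _ _)); rewrite mem_frame.
  by apply: (subvP (addvSr _ _)); rewrite mem_frame.
- by move=> iA; rewrite mem_frame // inE iA.
- by move=> iA; rewrite mem_frame // inE iA orbT.
Qed.

Lemma spanf1 e i : spanf e [set i] = <[e i]>%VS.
Proof. by rewrite /spanf big_set1. Qed.

Lemma leq_dim_spanf e A : (\dim (spanf e A) <= #|A|)%N.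
Proof.
apply: leq_trans (dimv_leq_sum _ _ _) _; rewrite -sum1_card.
by apply: leq_sum => i _; rewrite dim_vline; case: (_ != _).
Qed.

Lemma dim_spanf e A : frame e -> \dim (spanf e A) = #|A|.
Proof.
move=> fe; apply/eqP; rewrite eqn_leq leq_dim_spanf /=.
have := dimv_add_leqif (spanf e A) (spanf e (~: A)).
rewrite -spanfU setUCr frame_full // dimV => -[le _].
rewrite -(leq_add2r (\dim (spanf e (~: A)))); apply: leq_trans le.
apply: leq_trans (leq_add (leqnn _) (leq_dim_spanf e (~: A))) _.
by rewrite cardsC card_idx mul2n.
Qed.

Lemma perp_spanf e A : frame e -> perp (spanf e A) = spanf e (~: flips A).
Proof.
move=> fe; apply/vspaceP => v; apply/mem_orthovP/(mem_spanf _ _ fe) => vA.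
  by move=> i; rewrite inE negbK mem_flips => /(mem_frame e)/vA.
move=> _ /spanf_sum[c ->]; rewrite form_sumr big1 // => i iA.
by rewrite -[i]flipK vA ?mulr0 // inE negbK mem_flips flipK.
Qed.

Definition isov U := (U <= perp U)%VS.

Lemma isov_spanf e A : frame e -> isov (spanf e A) = isotropic A.
Proof.
move=> fe; rewrite /isov perp_spanf // spanfS //.
apply/subsetP/isotropicP => h i /h; rewrite !inE //.
Qed.

Lemma isovS U W : (U <= W)%VS -> isov W -> isov U.
Proof. by move=> UW isoW; apply: subv_trans (perpS UW); apply: subv_trans UW isoW. Qed.

(** * Extension of partial frames *)

(** Values of [e] outside [J] are arbitrary. Independence is a separate clause because the pairing
    does not detect members whose partner is missing from [J]. *)
Definition partial_frame J e :=
  (forall c : idx -> F, \sum_(i in J) c i *: e i = 0 -> forall i, i \in J -> c i = 0)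
  /\ {in J &, forall i j, ('[e i, e j] != 0) = (j == flip i)}.

Definition upd e i y j := if j == i then y else e j.

Lemma partial_frame0 e : partial_frame set0 e.
Proof. by split=> [c _ i|i j]; rewrite inE. Qed.

Lemma partial_frame_upd J e i y : partial_frame J e -> i \notin J ->
  {in J, forall j, j != flip i -> '[y, e j] = 0} ->
  (flip i \in J -> '[y, e (flip i)] != 0) ->
  y \notin spanf e J -> partial_frame (i |: J) (upd e i y).
Proof.
move=> [indep sympJ] iJ yJ y_flip y_span.
have off j : j \in J -> (j == i) = false.
  by move=> jJ; apply: contraNF iJ => /eqP <-.
split=> [c|j k].
  rewrite big_setU1 //= {1}/upd eqxx.
  under eq_bigr => j jJ do rewrite /upd off //.
  move=> sum0; have ci : c i = 0.
    apply: contraNeq y_span => ci.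
    have ciy : c i *: y = - \sum_(j in J) c j *: e j.
      by apply/eqP; rewrite -addr_eq0 sum0.
    rewrite -(scalerK ci y) ciy memvZ // memvN.
    by apply: memv_suml => j jJ; rewrite memvZ ?mem_frame.
  move: sum0; rewrite ci scale0r add0r => sum0 j.
  by rewrite !inE => /orP[/eqP-> //|]; exact: indep.
have yE k' : k' \in J -> ('[y, e k'] != 0) = (k' == flip i).
  have [-> /y_flip-> //|ki kJ] := eqVneq k' (flip i).
  by rewrite yJ ?eqxx.
rewrite /upd !inE => /orP[/eqP-> |jJ] /orP[/eqP-> |kJ]; rewrite ?eqxx ?off //.
- by rewrite form_alt eqxx eq_sym flip_neq.
- exact: yE.
- by rewrite form_eq0C yE // eq_flipC.
exact: sympJ.
Qed.

(** If [J] is closed under [flip], its span is nondegenerate and any nonzero vector orthogonal to it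
    opens a new pair. Otherwise some [e j] has no partner, and independence yields a vector
    orthogonal to the other members but not to [e j]. *)
Lemma ext_frame_step J e : partial_frame J e -> J != setT ->
  exists i y, i \notin J /\ partial_frame (i |: J) (upd e i y).
Proof.
move=> pJ JT; have [indep sympJ] := pJ.
suff [i [y [iJ yJ y_flip ys]]] : exists i y, [/\ i \notin J,
    {in J, forall j, j != flip i -> '[y, e j] = 0},
    flip i \in J -> '[y, e (flip i)] != 0 & y \notin spanf e J].
  by exists i, y; split=> //; exact: partial_frame_upd.
have [closed|] := boolP [forall i in J, flip i \in J].
  have [i iJ] : exists i, i \notin J.
    by apply/existsP; rewrite -negb_forall; apply: contra JT => /forallP JT;
       apply/eqP/setP => i; rewrite inE JT.
  pose U := spanf e J.
  have U0 : perp U != 0%VS.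
    rewrite -dimv_eq0 dim_perp dimV -lt0n subn_gt0.
    apply: leq_ltn_trans (leq_dim_spanf _ _) _.
    have -> : (2 * n = #|{: idx}|)%N by rewrite card_idx mul2n.
    by rewrite -cardsT proper_card // properT.
  exists i, (vpick (perp U)); split=> //.
  - move=> j jJ _; move/mem_orthovP: (memv_pick (perp U)); apply.
    exact: mem_frame.
  - by move=> /(forall_inP closed); rewrite flipK (negPf iJ).
  apply: contra U0 => /spanf_sum[c defy]; rewrite -vpick0 defy big1 // => j jJ.
  have fjJ := forall_inP closed _ jJ.
  have : '[\sum_(j in J) c j *: e j, e (flip j)] = 0.
    by rewrite -defy; have /mem_orthovP-> := memv_pick (perp U); last exact: mem_frame.
  rewrite form_suml (bigD1 j) //= big1 => [|k /andP[kJ kj]].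
    rewrite addr0 => /eqP; rewrite mulf_eq0 (negPf (_ : '[_, _] != 0)) ?sympJ //.
    by rewrite orbF => /eqP->; rewrite scale0r.
  have /eqP-> : '[e k, e (flip j)] == 0; last by rewrite mulr0.
  by rewrite -[_ == _]negbK sympJ // (inj_eq (@flip_inj n)) eq_sym.
rewrite negb_forall_in => /exists_inP[j jJ fjJ].
have : e j \notin spanf e (J :\ j).
  apply/negP => /spanf_sum[c ejE].
  have := indep (fun k => if k == j then -1 else c k) _ j jJ.
  rewrite eqxx => h; suff /eqP : (-1 : F) = 0 by rewrite oppr_eq0 oner_eq0.
  apply: h; rewrite (big_setD1 j) //= eqxx scaleN1r {1}ejE addrC.
  apply/eqP; rewrite subr_eq0; apply/eqP; apply: eq_bigr => k.
  by rewrite !inE => /andP[/negPf-> _].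
case/ex_perp_notin=> y /mem_orthovP yJ y_ej.
exists (flip j), y; split=> //; rewrite ?flipK.
- by move=> k kJ kj; apply/yJ/mem_frame; rewrite !inE kj.
- by rewrite form_eq0C.
apply: contra y_ej => /spanf_sum[c ->].
rewrite form_eq0C form_suml big1 // => k kJ.
have /eqP-> : '[e k, e j] == 0; last by rewrite mulr0.
by rewrite -[_ == _]negbK sympJ //; apply: contraNneq fjJ => ->; rewrite flipK.
Qed.

Lemma ext_frame J e : partial_frame J e ->
  exists2 e', frame e' & {in J, forall i, e' i = e i}.
Proof.
move: {2}#|~: J| (erefl #|~: J|) => m.
elim: m J e => [|m IH] J e cJ pJ.
  move/eqP: cJ; rewrite cards_eq0 -setCT => /eqP/setC_inj JT.
  exists e => // i j; case: pJ => _; rewrite JT => h; exact: h.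
have JT : J != setT.
  by apply/eqP => JT; move: cJ; rewrite JT setCT cards0.
have [i [y [iJ pJ']]] := ext_frame_step pJ JT.
have [|e' fe' e'J] := IH _ _ _ pJ'.
  have /eqP := cardsC J; rewrite -(cardsC (i |: J)) cardsU1 iJ cJ add1n addSnnS.
  by rewrite eqn_add2l eqSS => /eqP.
exists e' => // j jJ; rewrite e'J ?inE ?jJ ?orbT //.
by rewrite /upd; case: eqP => // ji; move: iJ; rewrite -ji jJ.
Qed.

(** Vectors of [U] are added one by one, at indices [i] with neither [i] nor [flip i] in [J]. If no
    such index existed, the orthogonal of [spanf e J] would lie inside [spanf e J], and so would
    [U]. *)
Lemma ext_isov J e U : partial_frame J e -> isov U ->
  (U <= perp (spanf e J))%VS -> (U :&: spanf e J = 0)%VS ->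
  exists e' A, [/\ frame e', {in J, forall i, e' i = e i},
    [disjoint A & J] & spanf e' A = U].
Proof.
move: {2}(\dim U) (erefl (\dim U)) => d.
elim: d U J e => [|d IH] U J e dimU pJ isoU UJ UJ0.
  have [e' fe' e'J] := ext_frame pJ; exists e', set0; split=> //.
    by rewrite -setI_eq0 set0I.
  by apply/esym/eqP; rewrite /spanf big_set0 -dimv_eq0 dimU.
have spJ e' : {in J, forall i, e' i = e i} -> spanf e' J = spanf e J.
  by move=> e'J; apply: eq_bigr => i /e'J->.
have U0 : U != 0%VS by rewrite -dimv_eq0 dimU.
have [i iJ fiJ] : exists2 i, i \notin J & flip i \notin J.
  have [/exists_inP[i iJ fiJ]|] := boolP [exists i in ~: J, flip i \notin J].
    by exists i => //; rewrite inE in iJ.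
  rewrite negb_exists_in => /forall_inP all_J.
  have [e' fe' e'J] := ext_frame pJ.
  case/negP: U0; rewrite -UJ0 eq_sym; apply/eqP/capv_idPl.
  apply: subv_trans UJ _; rewrite -(spJ e') //.
  rewrite perp_spanf // spanfS //; apply/subsetP => i; rewrite !inE.
  by move=> fiJ; apply: contraT => iJ; have := all_J i; rewrite inE iJ fiJ => /(_ isT).
pose u := vpick U; have uU : u \in U by exact: memv_pick.
have u0 : u != 0 by rewrite vpick0.
have uspan : u \notin spanf e J.
  apply: contra u0 => uJ; rewrite -memv0 -UJ0 memv_cap uU; exact: uJ.
have uJ j : j \in J -> '[u, e j] = 0.
  by move=> jJ; have /mem_orthovP := subvP UJ _ uU; apply; exact: mem_frame.
have pJ' : partial_frame (i |: J) (upd e i u).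
  apply: partial_frame_upd => //; first by move=> j jJ _; exact: uJ.
  by rewrite (negPf fiJ).
pose W := (U :\: <[u]>)%VS.
have WU : (W <= U)%VS by exact: diffvSl.
have WuU : (W + <[u]> = U)%VS by rewrite addv_diff; apply/addv_idPl; rewrite -memvE.
have Wu0 : (W :&: <[u]> = 0)%VS by exact: capv_diff.
have dimW : \dim W = d.
  have := dimv_disjoint_sum Wu0; rewrite WuU dimU dim_vline u0 addn1.
  by case.
have upd_span : spanf (upd e i u) (i |: J) = (<[u]> + spanf e J)%VS.
  rewrite /spanf big_setU1 //= /upd eqxx; congr (_ + _)%VS.
  by apply: eq_bigr => j jJ; case: eqP => // ji; rewrite -ji jJ in iJ.
have [||| e' [A [fe' e'J dis defW]]] := IH W _ _ dimW pJ'.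
- exact: isovS WU isoU.
- rewrite upd_span perpD subv_cap (subv_trans WU UJ) andbT.
  apply: subv_trans WU _; apply: subv_trans isoU _; apply: perpS.
  by rewrite -memvE.
- rewrite upd_span; apply/eqP; rewrite -subv0; apply/subvP => v.
  rewrite memv_cap => /andP[vW /memv_addP[_ /vlineP[a ->] [t tJ defv]]].
  have tU : t \in U.
    have -> : t = v - a *: u by rewrite defv addrC addKr.
    by rewrite memvB ?memvZ // (subvP WU).
  have t0 : t = 0 by apply/eqP; rewrite -memv0 -UJ0 memv_cap tU.
  have vu : v \in <[u]>%VS by rewrite defv t0 addr0 memvZ ?memv_line.
  by rewrite -Wu0 memv_cap vW.
exists e', (i |: A); split=> //.
- move=> j jJ; rewrite e'J ?inE ?jJ ?orbT // /upd.
  by case: eqP => // ji; rewrite -ji jJ in iJ.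
- rewrite disjoints_subset subUset sub1set inE iJ -disjoints_subset.
  apply: disjointWr dis; exact: subsetUr.
rewrite spanfU spanf1 defW addvC e'J ?inE ?eqxx // /upd eqxx; exact: WuU.
Qed.

Lemma nonzero_idx x : x != 0 -> exists i : idx, True.
Proof.
move=> x0; have : (0 < \dim {:V})%N.
  by apply: leq_trans (dimvS (subvf <[x]>)); rewrite dim_vline x0.
rewrite dimV muln_gt0 /= => n_gt0; by exists (Ordinal n_gt0, false).
Qed.

Lemma partial_frame1 i x : x != 0 ->
  partial_frame [set i] (upd (fun=> 0) i x).
Proof.
move=> x0; rewrite -[[set i]]setU0.
apply: partial_frame_upd (partial_frame0 _) _ _ _ _.
- by rewrite inE.
- by move=> j; rewrite inE.
- by rewrite inE.
- by rewrite /spanf big_set0 memv0.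
Qed.

Lemma isov_line x : isov <[x]>.
Proof. by rewrite /isov orthov11 form_alt. Qed.

Lemma frame_isov U : isov U -> exists e A, frame e /\ spanf e A = U.
Proof.
move=> isoU; pose e0 : idx -> V := fun=> 0.
have s0 : spanf e0 set0 = 0%VS by rewrite /spanf big_set0.
have [||e [A [fe _ _ defU]]] := ext_isov (partial_frame0 e0) isoU.
- by rewrite s0 orthov0 subvf.
- by rewrite s0 capv0.
by exists e, A.
Qed.

Lemma frame_point U x : isov U -> x \in U -> x != 0 ->
  exists e A i, [/\ frame e, i \in A, e i = x & spanf e A = U].
Proof.
move=> isoU xU x0; have [i _] := nonzero_idx x0.
have pJ := partial_frame1 i x0; set e0 := upd _ _ _ in pJ.
have s0 : spanf e0 [set i] = <[x]>%VS by rewrite spanf1 /e0 /upd eqxx.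
pose W := (U :\: <[x]>)%VS; have WU : (W <= U)%VS by exact: diffvSl.
have xUv : (<[x]> <= U)%VS by rewrite -memvE.
have [|||e [A [fe eJ _ defW]]] := @ext_isov _ _ W pJ.
- exact: isovS WU isoU.
- by rewrite s0; apply: subv_trans WU _; apply: subv_trans isoU (perpS xUv).
- by rewrite s0 capv_diff.
have ei : e i = x by rewrite eJ ?inE // /e0 /upd eqxx.
exists e, (i |: A), i; split; rewrite ?inE ?eqxx //.
by rewrite spanfU spanf1 defW ei addvC addv_diff; exact/addv_idPl.
Qed.

(** The plane of a hyperbolic pair meets its own orthogonal, hence [U], trivially, so [ext_isov]
    applies. *)
Lemma frame_hyperbolic U x y : isov U -> x \in perp U -> y \in perp U ->
  '[x, y] != 0 ->
  exists e A i, [/\ frame e, i \notin A, flip i \notin A, spanf e A = U &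
                    e i = x /\ e (flip i) = y].
Proof.
move=> isoU xU yU xy.
have x0 : x != 0 by apply: contraNneq xy => ->; rewrite linear0l.
have [i _] := nonzero_idx x0; have fi_i : flip i != i by rewrite flip_neq.
pose e0 := upd (upd (fun=> 0) i x) (flip i) y.
have e0i : e0 i = x by rewrite /e0 /upd eq_sym (negPf fi_i) eqxx.
have e0fi : e0 (flip i) = y by rewrite /e0 /upd eqxx.
have pJ : partial_frame (flip i |: [set i]) e0.
  apply: partial_frame_upd (partial_frame1 i x0) _ _ _ _.
  - by rewrite inE.
  - by move=> j; rewrite inE flipK => /eqP-> /eqP.
  - by rewrite flipK /upd eqxx form_eq0C.
  rewrite spanf1 /upd eqxx; apply: contra xy => /vlineP[a ->].
  by rewrite formZr form_alt mulr0.
have s0 : spanf e0 (flip i |: [set i]) = (<[y]> + <[x]>)%VS.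
  by rewrite spanfU !spanf1 e0i e0fi.
have [||e [A [fe eJ dis defU]]] := ext_isov pJ isoU.
- by rewrite s0 orthov_sym subv_add -!memvE yU.
- apply/eqP; rewrite -subv0 s0; apply/subvP => v.
  rewrite memv_cap => /andP[vU /memv_addP[_ /vlineP[b ->] [_ /vlineP[a ->] defv]]].
  have a0 : a = 0.
    have : '[v, y] = 0 by rewrite formC (mem_orthovP yU) ?oppr0.
    rewrite defv formDl !formZl form_alt mulr0 add0r => /eqP.
    by rewrite mulf_eq0 (negPf xy) orbF => /eqP.
  have b0 : b = 0.
    have : '[x, v] = 0 by apply: (mem_orthovP xU).
    rewrite defv formDr !formZr form_alt mulr0 addr0 => /eqP.
    by rewrite mulf_eq0 (negPf xy) orbF => /eqP.
  by rewrite defv a0 b0 !scale0r addr0 mem0v.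
exists e, A, i; split=> //.
- have := disjointFl dis (_ : i \in _); rewrite !inE eqxx orbT.
  by move=> ->.
- have := disjointFl dis (_ : flip i \in _); rewrite !inE eqxx.
  by move=> ->.
by rewrite !eJ ?inE ?eqxx ?orbT.
Qed.

(** Only the line of [y] is recovered, since [ext_isov] controls spans and not generators. *)
Lemma frame_orthogonal x y : x != 0 -> y \notin <[x]>%VS -> '[x, y] = 0 ->
  exists e i j, [/\ frame e, i != j, e i = x & <[e j]>%VS = <[y]>%VS].
Proof.
move=> x0 yx xy; have [i _] := nonzero_idx x0.
have pJ := partial_frame1 i x0; set e0 := upd _ _ _ in pJ.
have s0 : spanf e0 [set i] = <[x]>%VS by rewrite spanf1 /e0 /upd eqxx.
have y0 : y != 0 by apply: contraNneq yx => ->; rewrite mem0v.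
have [||e [A [fe eJ dis defy]]] := ext_isov pJ (isov_line y).
- by rewrite s0 orthov11 form_eq0C xy.
- apply/eqP; rewrite -subv0 s0; apply/subvP => v.
  rewrite memv_cap => /andP[/vlineP[a ->] avx].
  have [->|a0] := eqVneq a 0; first by rewrite scale0r mem0v.
  by move: yx; rewrite -(scalerK a0 y) memvZ.
have /cards1P[j defA] : #|A| == 1%N by rewrite -(dim_spanf _ fe) defy dim_vline y0.
exists e, i, j; split=> //; last by rewrite -spanf1 -defA.
  apply: contraTneq dis => ij.
  by apply/pred0Pn; exists i; rewrite /= defA ij !inE eqxx.
by rewrite eJ ?inE // /e0 /upd eqxx.
Qed.

(* For j = flip i the second clause is vacuous, and e is changed at i only. *)
Definition transv e i j : idx -> V := fun t =>
  if t == i then e i + e j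
  else if t == flip j
  then e (flip j) - ('[e j, e (flip j)] / '[e i, e (flip i)]) *: e (flip i)
  else e t.

(** The coefficient in [transv] keeps [e i + e j] orthogonal to the modified vector at [flip j];
    only the rows at [i] and [flip j] change. *)
Lemma transv_frame e i j : frame e -> i != j -> frame (transv e i j).
Proof.
move=> fe ij; pose e2 := transv e i j.
have z := frame_eq0 fe.
have row_i t : ('[e2 i, e2 t] != 0) = (t == flip i).
  rewrite /e2 /transv eqxx; have [->|ti] := eqVneq t i.
    by rewrite form_alt eqxx eq_sym flip_neq.
  have [-> |tj] := eqVneq t (flip j).
    rewrite formDl !linearBr /= !formZr.
    have -> : '[e j, e (flip i)] = 0 by rewrite z // (inj_eq (@flip_inj n)).
    have -> : '[e i, e (flip j)] = 0 by rewrite z // (inj_eq (@flip_inj n)) eq_sym.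
    rewrite mulr0 subr0 add0r divfK ?frame_neq0 // addNr eqxx.
    by rewrite (inj_eq (@flip_inj n)) eq_sym (negPf ij).
  by rewrite formDl (z j t) // addr0 fe.
have row_j t : i != flip j -> ('[e2 (flip j), e2 t] != 0) = (t == j).
  move=> ifj; have [-> |ti] := eqVneq t i.
    by rewrite form_eq0C row_i (inj_eq (@flip_inj n)) [RHS]eq_sym.
  have [-> |tj] := eqVneq t (flip j); first by rewrite form_alt eqxx flip_neq.
  rewrite /e2 /transv [flip j == i]eq_sym (negPf ifj) eqxx (negPf ti) (negPf tj).
  rewrite linearBl /= formZl (z (flip i) t); last by rewrite flipK.
  by rewrite mulr0 subr0 fe flipK.
move=> s t; have [-> |si] := eqVneq s i; first exact: row_i.
have [-> |ti] := eqVneq t i; first by rewrite form_eq0C row_i eq_flipC.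
have [sj|sj] := eqVneq s (flip j).
  by rewrite sj row_j ?flipK // -sj eq_sym.
have [tj|tj] := eqVneq t (flip j).
  by rewrite tj form_eq0C row_j ?(inj_eq (@flip_inj n)) 1?[RHS]eq_sym // -tj eq_sym.
by rewrite /e2 /transv (negPf si) (negPf ti) (negPf sj) (negPf tj) fe.
Qed.

(** The hypothesis puts [j] in [A] whenever [i] is, and [flip i] whenever [flip j] is, so the added
    terms stay in the span. *)
Lemma transv_over e i j A : frame e -> i != j -> ~~ over i j A ->
  spanf (transv e i j) A = spanf e A.
Proof.
move=> fe ij; rewrite /over negb_or !negb_and !negbK => /andP[iA jA].
apply/eqP; rewrite eqEdim !dim_spanf ?leqnn ?andbT //; last exact: transv_frame.
apply/spanf_subP => t tA; rewrite /transv; case: eqP => [ti|_].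
  by rewrite memvD ?mem_frame //; move: iA; rewrite -ti tA.
case: eqP => [tj|_]; last exact: mem_frame.
by rewrite memvB ?memvZ ?mem_frame // -?tj //; move: jA; rewrite -tj tA.
Qed.

(** The reflection in the root [(i, j)]; for [j = flip i] it moves only [i] and [flip i]. *)
Definition swap i j (t : idx) : idx :=
  if t == i then j else if t == j then i
  else if t == flip i then flip j else if t == flip j then flip i else t.

Lemma swapK i j : i != j -> involutive (swap i j).
Proof.
move=> ij t; rewrite /swap.
have [->|ti] := eqVneq t i.
  by rewrite eqxx eq_sym (negPf ij).
have [->|tj] := eqVneq t j; first by rewrite eqxx.
have [-> |tfi] := eqVneq t (flip i).
  have [fji|fji] := eqVneq (flip j) i; first by rewrite -fji flipK.
  rewrite flip_neq (inj_eq (@flip_inj n)) eq_sym (negPf ij).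
  by rewrite eqxx.
have [-> |tfj] := eqVneq t (flip j).
  rewrite flip_neq; have [fij|fij] := eqVneq (flip i) j.
    by rewrite -fij flipK.
  by rewrite eqxx.
by rewrite (negPf ti) (negPf tj) (negPf tfi) (negPf tfj).
Qed.

Lemma swap_flip i j t : i != j -> swap i j (flip t) = flip (swap i j t).
Proof.
case: i j t => [i b] [j c] [t d]; rewrite /swap /flip !xpair_eqE /=.
have [->|_] := eqVneq t i; first by
  have [->|_] := eqVneq i j; move: b c d; do 3!case.
by have [->|_] := eqVneq t j; move: b c d; do 3!case.
Qed.

Lemma swap_adm m i j A : i != j -> A \in admissible n m ->
  swap i j @^-1: A \in admissible n m.
Proof.
move=> ij /admissibleP[/isotropicP isoA cA]; apply/admissibleP; split.
  by apply/isotropicP => t; rewrite !inE swap_flip // => /isoA.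
rewrite on_card_preimset //; exists (swap i j) => t _; exact: swapK.
Qed.

Lemma swap_over i j A : i != j ->
  over j i (swap i j @^-1: A) = over i j A.
Proof.
move=> ij; rewrite /over !inE !swap_flip //.
have -> : swap i j i = j by rewrite /swap eqxx.
have -> : swap i j j = i by rewrite /swap eq_sym (negPf ij) eqxx.
by [].
Qed.

(* The rank one relation between opposite root subgroups and the reflection. *)
Lemma transv_swap e i j A : frame e -> i != j -> isotropic A -> over i j A ->
  spanf (transv e i j) A = spanf (transv e j i) (swap i j @^-1: A).
Proof.
move=> fe ij /isotropicP isoA oA; have ji : j != i by rewrite eq_sym.
have swij : swap i j i = j by rewrite /swap eqxx.
have swji : swap i j j = i by rewrite /swap eqxx (negPf ji).
have [jA fiA] : j \notin A /\ flip i \notin A.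
  move: oA; rewrite /over; case/orP=> /andP[a b]; split=> //; first exact: isoA.
  by rewrite -[j]flipK isoA.
apply/eqP; rewrite eqEdim !dim_spanf; try exact: transv_frame.
rewrite on_card_preimset ?leqnn ?andbT; last first.
  by exists (swap i j) => t _; exact: swapK.
apply/spanf_subP => t; have [-> iA|ti tA] := eqVneq t i.
  have -> : transv e i j i = transv e j i j by rewrite /transv !eqxx addrC.
  by rewrite mem_frame // inE swji.
have [tj|tj] := eqVneq t (flip j).
  have fji : (flip j == i) = false by rewrite -tj; exact: negbTE.
  have ne := frame_neq0 _ fe; pose a := '[e j, e (flip j)] / '[e i, e (flip i)].
  (* The modified vectors of the two frames are proportional with ratio [- a]. *)
  have -> : transv e i j t = - a *: transv e j i (flip i).
    have fij : (flip i == j) = false by rewrite eq_flip eq_sym.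
    rewrite tj /transv fji fij !eqxx -/a scalerBr scalerA mulNr !scaleNr opprK addrC.
    by rewrite {2}/a mulrA divfK // divff // scale1r addrC.
  rewrite memvZ // mem_frame // inE swap_flip // swij -tj //.
have tj' : t != j by apply: contraNneq jA => <-.
have tfi : t != flip i by apply: contraNneq fiA => <-.
have -> : transv e i j t = transv e j i t.
  by rewrite /transv (negPf ti) (negPf tj) (negPf tj') (negPf tfi).
rewrite mem_frame // inE /swap.
by rewrite (negPf ti) (negPf tj) (negPf tj') (negPf tfi).
Qed.

(* The members of R and their orthogonals separate the points of the frame e, *)
(* so each <[e i]> is an intersection of subspaces spanned by parts of e2.    *)
Lemma frame_exact e e2 (R : {set {set idx}}) : frame e -> frame e2 ->
  (forall A, A \in R -> exists Y, spanf e A = spanf e2 Y) ->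
  (forall i j, i != j -> exists2 A, A \in R & over i j A) ->
  exists2 tau : idx -> idx, injective tau &
    forall A, spanf e A = spanf e2 (tau @: A).
Proof.
move=> fe fe2 R2 Rsep.
pose L X := [exists Y, spanf e X == spanf e2 Y].
have LP X : reflect (exists Y, spanf e X = spanf e2 Y) (L X).
  by apply: (iffP existsP) => -[Y /eqP]; exists Y.
have LI X Y : L X -> L Y -> L (X :&: Y).
  move=> /LP[X' defX] /LP[Y' defY]; apply/LP; exists (X' :&: Y').
  by rewrite -!spanf_cap // defX defY.
have LC X : L X -> L (~: flips X).
  move=> /LP[X' defX]; apply/LP; exists (~: flips X').
  by rewrite -!perp_spanf // defX.
have sepP i j : exists X, (i != j) ==> [&& L X, i \in X & j \notin X].
  have [->|ij] := eqVneq i j; first by exists set0.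
  have [A /R2/LP LA] := Rsep i j ij; rewrite /over => /orP[/andP[iA jA]|/andP[jA iA]].
    by exists A; rewrite LA iA.
  by exists (~: flips A); rewrite LC // !inE iA jA.
pose X i j := xchoose (sepP i j).
have XP i j : i != j -> [&& L (X i j), i \in X i j & j \notin X i j].
  by move=> ij; have /implyP := xchooseP (sepP i j); apply.
have L1 i : L [set i].
  have -> : [set i] = \bigcap_(j | j != i) X i j.
    apply/setP => k; rewrite inE; apply/eqP/bigcapP => [-> j|kX].
      by rewrite eq_sym => /XP/and3P[].
    apply/eqP; apply: contraT => ki.
    have := XP i k; rewrite eq_sym => /(_ ki)/and3P[_ _]; by rewrite kX.
  apply: (big_ind (fun Y => L Y)) => [|A B|j ji].
  - by apply/LP; exists setT; rewrite !frame_full.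
  - exact: LI.
  - by have := XP i j; rewrite eq_sym => /(_ ji)/and3P[].
have tauP i : exists j, spanf e [set i] == spanf e2 [set j].
  have /LP[Y defY] := L1 i.
  have /cards1P[j YE] : #|Y| == 1%N.
    by rewrite -(dim_spanf _ fe2) -defY dim_spanf // cards1.
  by exists j; rewrite defY YE.
pose tau i := xchoose (tauP i).
have tauE i : <[e i]>%VS = <[e2 (tau i)]>%VS.
  by rewrite -!spanf1; apply/eqP/(xchooseP (tauP i)).
exists tau => [i j ij|A].
  apply/set1P; rewrite -(frame_mem _ _ fe) spanf1 tauE -ij -tauE -spanf1.
  by rewrite mem_frame ?inE.
apply/eqP; rewrite eqEsubv; apply/andP; split; apply/spanf_subP.
  by move=> i iA; rewrite memvE tauE -memvE mem_frame ?imset_f.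
by move=> _ /imsetP[i iA ->]; rewrite memvE -tauE -memvE mem_frame.
Qed.
End Symplectic.

(** * Maps preserving base subsets *)

Section BaseMaps.
Variables (n : nat) (F F' : fieldType) (V : vectType F) (V' : vectType F').
Hypotheses (dimV : \dim {:V} = (2 * n)%N) (dimV' : \dim {:V'} = (2 * n)%N).
Variables (Omega : {skew_symmetric V}) (Omega' : {skew_symmetric V'}).
Hypotheses (sympO : is_psymplectic Omega) (sympO' : is_psymplectic Omega').
Local Notation idx := (idx n).
Implicit Types (i j k : idx) (A B : {set idx}).
Implicit Types (g h : {vspace V} -> {vspace V'}).

(** Injectivity is asked on all index sets, so that [phi] is a permutation of a finite type. *)
Definition base_map m g (e : idx -> V) (e' : idx -> V') (phi : {set idx} -> {set idx}) :=
  [/\ frame Omega' e', injective phi,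
      forall A, A \in admissible n m -> phi A \in admissible n m
    & forall A, A \in admissible n m -> g (spanf e A) = spanf e' (phi A)].

Definition preserves_bases m g :=
  forall e, frame Omega e -> exists e' phi, base_map m g e e' phi.

Lemma base_map_onto m g e e' phi B : base_map m g e e' phi ->
  B \in admissible n m -> exists2 A, A \in admissible n m & B = phi A.
Proof.
case=> _ phi_inj phi_adm _ mB.
have im_adm : phi @: admissible n m = admissible n m.
  apply/eqP; rewrite eqEcard card_imset // leqnn andbT.
  by apply/subsetP => _ /imsetP[A mA ->]; exact: phi_adm.
by move: mB; rewrite -{1}im_adm => /imsetP[A mA ->]; exists A.
Qed.

(** On admissible sets, surjectivity and finiteness give injectivity; elsewhere [phi] is the
    identity. *)
Lemma base_map_surj m g (e : idx -> V) e' : frame Omega' e' ->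
  (forall A, A \in admissible n m ->
    exists2 B, B \in admissible n m & g (spanf e A) = spanf e' B) ->
  (forall B, B \in admissible n m ->
    exists2 A, A \in admissible n m & g (spanf e A) = spanf e' B) ->
  exists phi, base_map m g e e' phi.
Proof.
move=> fe' gA gB.
have ex_phi A : exists B, if A \in admissible n m
    then (B \in admissible n m) && (g (spanf e A) == spanf e' B) else B == A.
  case: (boolP (A \in admissible n m)) => [/gA[B mB gAB]|_]; last by exists A.
  by exists B; rewrite mB gAB eqxx.
pose phi A := xchoose (ex_phi A).
have phiP A : A \in admissible n m ->
    phi A \in admissible n m /\ g (spanf e A) = spanf e' (phi A).
  by move=> mA; have := xchooseP (ex_phi A); rewrite -/(phi A) {1}mA => /andP[? /eqP].
have phiN A : A \notin admissible n m -> phi A = A.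
  by move=> mA; have := xchooseP (ex_phi A); rewrite -/(phi A) {1}(negPf mA) => /eqP.
have im_adm : phi @: admissible n m = admissible n m.
  apply/setP => B; apply/imsetP/idP => [[A mA ->]|mB].
    by have [] := phiP A mA.
  have [A mA gAB] := gB B mB; exists A => //.
  by apply: (spanf_inj dimV' fe'); rewrite -gAB (phiP A mA).2.
have phi_inj : {in admissible n m &, injective phi}.
  by apply/imset_injP; rewrite im_adm.
exists phi; split=> //; last 2 first.
- by move=> A /phiP[].
- by move=> A /phiP[].
move=> A B AB; have [mA|mA] := boolP (A \in admissible n m);
  have [mB|mB] := boolP (B \in admissible n m).
- exact: phi_inj.
- by have [] := phiP A mA; rewrite AB (phiN _ mB) (negPf mB).
- by have [] := phiP B mB; rewrite -AB (phiN _ mA) (negPf mA).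
by rewrite -(phiN _ mA) AB phiN.
Qed.

Section Fixed.
Variables (m : nat) (g : {vspace V} -> {vspace V'}).
Hypotheses (m_gt0 : (0 < m)%N) (m_le_n : (m <= n)%N).
Hypothesis g_bases : preserves_bases m g.

(* The base subsets of the frames e, transv e i j and transv e j i have the   *)
(* property that the symmetric difference of the first two is contained in    *)
(* the third; as g is injective on the third, it separates the first two.     *)
Lemma base_map_half e e' phi i j : frame Omega e -> base_map m g e e' phi ->
  i != j -> exists k l, k != l /\ halfset m k l \subset phi @: halfset m i j.
Proof.
move=> fe phiP ij; have ji : j != i by rewrite eq_sym.
apply: contrapT => none.
have [fe' phi_inj phi_adm phiE] := phiP.
have fe2 := transv_frame sympO fe ij; have fe3 := transv_frame sympO fe ji.
have [e2' [phi2 phi2P]] := g_bases fe2; have [fe2' phi2_inj phi2_adm phi2E] := phi2P.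
have [e3' [phi3 [fe3' phi3_inj phi3_adm phi3E]]] := g_bases fe3.
pose R := phi @: (admissible n m :\: halfset m i j).
have nover A : A \in admissible n m -> A \notin halfset m i j -> ~~ over i j A.
  by move=> mA; rewrite mem_halfset mA.
(* By [none] every half-set contains a member of [R], so [R] separates indices, and [e'] and [e2']
   have the same points up to [tau]. *)
have [||tau tau_inj tauE] := frame_exact dimV' fe' fe2' (R := R).
- move=> _ /imsetP[A /setDP[mA ijA] ->]; exists (phi2 A).
  by rewrite -phiE // -phi2E // (transv_over dimV sympO) // nover.
- move=> k l kl; apply: contrapT => nR; apply: none; exists k, l; split=> //.
  apply/subsetP => B klB; move: (klB); rewrite mem_halfset => /andP[mB oB].
  have [A mA defB] := base_map_onto phiP mB.
  apply: contrapT => BR; apply: nR; exists B => //.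
  rewrite defB imset_f // in_setD mA andbT; apply/negP => ijA.
  by apply: BR; rewrite defB imset_f.
have [A0] := set0Pn _ (halfset_neq0 (introT andP (conj m_gt0 m_le_n)) ij).
rewrite mem_halfset => /andP[mA0 oA0].
have [isoA0 cA0] := admissibleP _ _ mA0.
have [B mB defB] : exists2 B, B \in admissible n m & tau @: B = phi2 A0.
  have tau_bij := injF_bij tau_inj.
  have defB : tau @: (tau @^-1: phi2 A0) = phi2 A0.
    apply/setP => k; apply/imsetP/idP => [[l]|kA0]; first by rewrite inE => ? ->.
    by case: tau_bij => tau' _ tauK; exists (tau' k); rewrite ?inE tauK.
  exists (tau @^-1: phi2 A0) => //.
  have /admissibleP[iso2 c2] := phi2_adm _ mA0.
  apply/admissibleP; split.
    by rewrite -(isov_spanf dimV' _ fe') tauE defB isov_spanf.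
  by rewrite -(card_imset _ tau_inj) defB.
have [A1 mA1 defB1] := base_map_onto phiP mB.
have gA01 : g (spanf (transv Omega e i j) A0) = g (spanf e A1).
  by rewrite phi2E // phiE // -defB -tauE defB1.
(* Injectivity fails either way: on the third base, between [swap i j @^-1: A0] and [A1], or on the
   second, between [A0] and [A1]. *)
have [oA1|oA1] := boolP (over i j A1).
  have isoA1 := (admissibleP _ _ mA1).1.
  have sA1 : swap i j @^-1: A0 = A1.
    apply: phi3_inj; apply: (spanf_inj dimV' fe3').
    rewrite -!phi3E ?swap_adm // -(transv_swap dimV sympO) // gA01.
    by rewrite (transv_over dimV sympO) // over_asym.
  by have := over_asym isoA1 oA1; rewrite -sA1 swap_over // oA0.
have A01 : A0 = A1.
  apply: phi2_inj; apply: (spanf_inj dimV' fe2').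
  by rewrite -!phi2E // gA01 (transv_over dimV sympO).
by rewrite -A01 oA0 in oA1.
Qed.

(** No nonzero vector of [S] is orthogonal to all of [T]; inside one base this singles out one
    partner of each member. *)
Definition opposite (S T : {vspace V'}) := (S :&: orthov Omega' T == 0)%VS.

Lemma opposite_spanf e' A B : frame Omega' e' ->
  A \in admissible n m -> B \in admissible n m ->
  opposite (spanf e' A) (spanf e' B) = (B == flips A).
Proof.
move=> fe' /admissibleP[_ cA] /admissibleP[_ cB].
rewrite /opposite (perp_spanf dimV') // (spanf_cap dimV' _ _ fe').
rewrite -dimv_eq0 (dim_spanf dimV' _ fe') cards_eq0 -setDE setD_eq0.
apply/idP/eqP => [sAB|->]; last by rewrite flipsK.
by apply/eqP; rewrite eq_sym eqEcard card_flips cA cB leqnn andbT;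
   apply/subsetP => x; rewrite inE => /(subsetP sAB); rewrite inE flipK.
Qed.

(* The frames e, transv e i j and transv e j i share all their members except *)
(* A0, flips A0, and a third subspace, and omit one of these three each.      *)
(* Uniqueness of opposites within each of the three image bases leaves no     *)
(* other opposite to the image of A0 than the image of flips A0.              *)
Lemma base_map_flips e e' phi i j A0 : frame Omega e -> base_map m g e e' phi ->
  i != j -> halfset m i j = [set A0] -> halfset m j i = [set flips A0] ->
  phi (flips A0) = flips (phi A0).
Proof.
move=> fe phiP ij hij hji; have ji : j != i by rewrite eq_sym.
apply: contrapT => phi_neq.
have [fe' phi_inj phi_adm phiE] := phiP.
have fe2 := transv_frame sympO fe ij; have fe3 := transv_frame sympO fe ji.
have [e2' [phi2 phi2P]] := g_bases fe2; have [fe2' phi2_inj phi2_adm phi2E] := phi2P.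
have [e3' [phi3 phi3P]] := g_bases fe3; have [fe3' phi3_inj phi3_adm phi3E] := phi3P.
have /andP[mA0 oA0] : (A0 \in admissible n m) && over i j A0.
  by rewrite -mem_halfset hij inE.
have mB0 := admissible_flips mA0; set B0 := flips A0 in hji phi_neq mB0.
have span2 A : A \in admissible n m -> A != A0 ->
    spanf (transv Omega e i j) A = spanf e A.
  move=> mA AA0; apply: (transv_over dimV sympO) => //.
  by have := mem_halfset m i j A; rewrite hij inE (negPf AA0) mA /= => <-.
have span3 A : A \in admissible n m -> A != B0 ->
    spanf (transv Omega e j i) A = spanf e A.
  move=> mA AB0; apply: (transv_over dimV sympO) => //.
  by have := mem_halfset m j i A; rewrite hji inE (negPf AB0) mA /= => <-.
have span23 : spanf (transv Omega e i j) A0 = spanf (transv Omega e j i) B0.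
  rewrite (transv_swap dimV sympO) //; last by case/admissibleP: mA0.
  congr spanf; apply/set1P; rewrite -hji mem_halfset swap_adm //=.
  by rewrite swap_over.
have flips_neq A : A \in admissible n m -> flips A != A.
  case/admissibleP=> isoA cA; apply/eqP => fA; have := isotropic_disjoint isoA.
  by rewrite fA setIid => A_0; move: m_gt0; rewrite -cA A_0 cards0.
have A0B0 : A0 != B0 by rewrite eq_sym flips_neq.
have opp1 A B : A \in admissible n m -> B \in admissible n m ->
    opposite (g (spanf e A)) (g (spanf e B)) = (phi B == flips (phi A)).
  by move=> mA mB; rewrite !phiE // opposite_spanf ?phi_adm.
have opp2 A B : A \in admissible n m -> B \in admissible n m ->
    opposite (g (spanf (transv Omega e i j) A)) (g (spanf (transv Omega e i j) B))
    = (phi2 B == flips (phi2 A)).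
  by move=> mA mB; rewrite !phi2E // opposite_spanf ?phi2_adm.
have opp3 A B : A \in admissible n m -> B \in admissible n m ->
    opposite (g (spanf (transv Omega e j i) A)) (g (spanf (transv Omega e j i) B))
    = (phi3 B == flips (phi3 A)).
  by move=> mA mB; rewrite !phi3E // opposite_spanf ?phi3_adm.
(* Here [s] and [t] are opposite to [A0] and [B0] in the first base, [u] to [B0] in the third, where
   [B0] labels the new subspace, and [w] to [u] in the first. For every position of [w], two
   distinct members of one base get the same opposite. *)
have [s ms phi_s] := base_map_onto phiP (admissible_flips (phi_adm _ mA0)).
have [t mt phi_t] := base_map_onto phiP (admissible_flips (phi_adm _ mB0)).
have [u mu phi_u] := base_map_onto phi3P (admissible_flips (phi3_adm _ mB0)).
have [w mw phi_w] := base_map_onto phiP (admissible_flips (phi_adm _ mu)).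
have sB0 : s != B0 by apply: contra_not_neq phi_neq => <-.
have tA0 : t != A0.
  by apply: contra_not_neq phi_neq => tA0; rewrite -tA0 -phi_t flipsK.
have s3 : phi3 s = flips (phi3 A0).
  by apply/eqP; rewrite -opp3 // !span3 // opp1 // phi_s.
have uB0 : u != B0.
  by apply: contraNneq (flips_neq _ (phi3_adm _ mB0)) => uB0; rewrite phi_u uB0.
have uA0 : u != A0.
  apply: contraNneq sB0 => uA0; apply/eqP/phi3_inj.
  by rewrite s3 -uA0 -phi_u flipsK.
have [wA0|wA0] := eqVneq w A0.
  have us : u = s by apply: phi_inj; rewrite -phi_s -wA0 -phi_w flipsK.
  have : phi3 A0 = phi3 B0 by apply: (inv_inj (@flipsK n)); rewrite phi_u us s3.
  by move/phi3_inj/eqP; rewrite (negPf A0B0).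
have [wB0|wB0] := eqVneq w B0.
  have ut : u = t by apply: phi_inj; rewrite -phi_t -wB0 -phi_w flipsK.
  have t2 : phi2 t = flips (phi2 B0).
    by apply/eqP; rewrite -opp2 // !span2 // 1?eq_sym // opp1 // phi_t.
  have u2 : phi2 u = flips (phi2 A0).
    apply/eqP; rewrite -opp2 // span23 (span2 u) // -(span3 u) // opp3 //.
    by rewrite phi_u.
  have : phi2 A0 = phi2 B0.
    by apply: (inv_inj (@flipsK n)); rewrite -u2 ut t2.
  by move/phi2_inj/eqP; rewrite (negPf A0B0).
have w3 : phi3 w = flips (phi3 u).
  by apply/eqP; rewrite -opp3 // !span3 // opp1 // phi_w.
case/eqP: wB0; apply: phi3_inj.
by rewrite w3 -phi_u flipsK.
Qed.

Lemma base_map_neighbours e e' phi A B : frame Omega e -> base_map m g e e' phi ->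
  A \in admissible n m -> B \in admissible n m ->
  neighbours (phi A) (phi B) = neighbours A B.
Proof.
move=> fe phiP; have [_ phi_inj phi_adm _] := phiP.
apply: (phi_neighboursE phi_inj phi_adm).
- by move=> i j; exact: base_map_half phiP.
- by move=> i j A1; exact: base_map_flips phiP.
by rewrite m_gt0.
Qed.
End Fixed.

(** * Hyperbolic adjacency and descent *)

(** That is, [S = U + <[x]>] and [T = U + <[y]>] with [U] their intersection and [x], [y] a
    hyperbolic pair orthogonal to [U]. *)
Definition hyper_adjacent d (S T : {vspace V'}) :=
  [/\ isov Omega' S /\ isov Omega' T, \dim S = d.+1, \dim T = d.+1,
      \dim (S :&: T) = d & ~~ (S <= orthov Omega' T)%VS].

(** Otherwise [Z] is the sum of its intersections with [S] and [T], so it lies in [S + T] and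
    together with [S :&: T] fills it. As [S :&: T] is orthogonal to [S + T] and [Z] is isotropic,
    [S] and [T] would be orthogonal. *)
Lemma hyper_adjacent_cap d S T Z :
  hyper_adjacent d S T -> hyper_adjacent d S Z -> hyper_adjacent d T Z ->
  (S :&: T <= Z)%VS.
Proof.
move=> [[isoS isoT] dS dT dST ST] [[_ isoZ] _ dZ dSZ _] [_ _ _ dTZ _].
have dim_lt U : (U <= Z)%VS -> (\dim U <= d)%N -> ~~ (Z <= U)%VS.
  by move=> UZ dU; apply/negP => /dimvS; rewrite dZ ltnNge dU.
have [eqSTZ|neqSTZ] := eqVneq (S :&: Z)%VS (T :&: Z)%VS.
  have sub : (S :&: Z <= S :&: T)%VS.
    by rewrite subv_cap capvSl eqSTZ capvSl.
  have /eqP<- : (S :&: Z)%VS == (S :&: T)%VS by rewrite eqEdim sub dSZ dST leqnn.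
  exact: capvSr.
have Z_ST : (Z <= S + T)%VS.
  have sZ : (S :&: Z + T :&: Z <= Z)%VS by rewrite subv_add !capvSr.
  suff /eqP<- : (S :&: Z + T :&: Z)%VS == Z by rewrite addvS ?capvSl.
  rewrite eqEdim sZ dZ ltnNge; apply/negP => dim_le.
  case/eqP: neqSTZ.
  have eqS : (S :&: Z)%VS == (S :&: Z + T :&: Z)%VS.
    by rewrite eqEdim addvSl dSZ.
  have eqT : (T :&: Z)%VS == (S :&: Z + T :&: Z)%VS.
    by rewrite eqEdim addvSr dTZ.
  by rewrite (eqP eqS) -(eqP eqT).
have UST : (S :&: T <= orthov Omega' (S + T))%VS.
  rewrite perpD subv_cap (subv_trans (capvSl _ _) isoS).
  exact: subv_trans (capvSr _ _) isoT.
have dimST : \dim (S + T) = d.+2 by have := dimv_sum_cap S T; lia.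
apply: contraT => UZ; case/negP: ST.
have ZU_ST : (Z + S :&: T)%VS == (S + T)%VS.
  rewrite eqEdim subv_add Z_ST (subv_trans (capvSl _ _) (addvSl _ _)) dimST.
  rewrite -dZ ltnNge /=; apply: contra UZ => dim_le.
  have /eqP-> : Z == (Z + S :&: T)%VS by rewrite eqEdim addvSl.
  exact: addvSr.
have U_perpZ : (S :&: T <= orthov Omega' Z)%VS := subv_trans UST (perpS _ Z_ST).
have isoST : isov Omega' (S + T).
  move: isoZ (isovS (capvSl S T) isoS); rewrite -(eqP ZU_ST) /isov => isoZ' isoU.
  by rewrite perpD subv_cap !subv_add isoZ' isoU U_perpZ orthov_sym U_perpZ.
apply: subv_trans (addvSl S T) _; apply: subv_trans isoST _.
by apply: perpS; exact: addvSr.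
Qed.

Section Descent.
Variables (d : nat) (g : {vspace V} -> {vspace V'}).
Hypothesis d_lt_n : (d < n)%N.
Hypothesis g_bases : preserves_bases d.+1 g.
Local Notation "''[' u , v ]" := (Omega u%R v%R) : ring_scope.
Local Notation perp := (orthov Omega).
Implicit Types (U S : {vspace V}) (x y z : V).

Lemma base_map_fresh e e' phi A i : frame Omega e -> base_map d.+1 g e e' phi ->
  A \in admissible n d -> i \notin A -> flip i \notin A ->
  exists B k, [/\ B \in admissible n d, k \notin B, flip k \notin B,
    phi (i |: A) = k |: B & phi (flip i |: A) = flip k |: B].
Proof.
move=> fe phiP mA iA fA; have [_ _ phi_adm _] := phiP.
have mi : i |: A \in admissible n d.+1 by exact: admissibleU1.
have mf : flip i |: A \in admissible n d.+1 by apply: admissibleU1; rewrite ?flipK.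
have : neighbours (phi (i |: A)) (phi (flip i |: A)).
  by rewrite (base_map_neighbours _ _ g_bases fe phiP) // neighboursU1.
case/neighboursP=> k kB defB; have mk := phi_adm _ mi.
have [/isotropicP isoB _] := admissibleP _ _ mk.
exists (phi (i |: A) :\ k), k; split=> //.
- exact: admissibleD1.
- by rewrite !inE eqxx.
- by rewrite !inE negb_and isoB // orbT.
by rewrite setD1K.
Qed.

(** In a frame through [U], [x] and [y], the two subspaces are neighbouring members of one base. *)
Lemma hyper_image U x y : isov Omega U -> \dim U = d ->
  x \in perp U -> y \in perp U -> '[x, y] != 0 ->
  hyper_adjacent d (g (U + <[x]>)%VS) (g (U + <[y]>)%VS).
Proof.
move=> isoU dU xU yU xy.
have [e [A [i [fe iA fA defU [ei efi]]]]] :=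
  frame_hyperbolic dimV sympO isoU xU yU xy.
have mA : A \in admissible n d.
  by apply/admissibleP; rewrite -(isov_spanf dimV _ fe) defU -(dim_spanf dimV _ fe) defU.
have addE k : (U + <[e k]>)%VS = spanf e (k |: A).
  by rewrite spanfU spanf1 defU addvC.
rewrite -ei -efi !addE.
have [e' [phi phiP]] := g_bases fe; have [fe' _ phi_adm phiE] := phiP.
have [B [k [mB kB fB phi_i phi_f]]] := base_map_fresh fe phiP mA iA fA.
have mi : i |: A \in admissible n d.+1 by exact: admissibleU1.
have mf : flip i |: A \in admissible n d.+1 by apply: admissibleU1; rewrite ?flipK.
have [iso_i c_i] := admissibleP _ _ (phi_adm _ mi).
have [iso_f c_f] := admissibleP _ _ (phi_adm _ mf).
rewrite !phiE //; split; rewrite ?(isov_spanf dimV' _ fe') ?(dim_spanf dimV' _ fe') //.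
  rewrite (spanf_cap dimV' _ _ fe') (dim_spanf dimV' _ fe') phi_i phi_f.
  by rewrite capU1_flip //; case/admissibleP: mB.
rewrite (perp_spanf dimV' _ fe') (spanfS dimV' _ _ fe') phi_i phi_f.
by apply/subsetPn; exists k; rewrite !inE eqxx.
Qed.

Let G U x y := (g (U + <[x]>) :&: g (U + <[y]>))%VS.

Let GC U x y : G U x y = G U y x. Proof. exact: capvC. Qed.

(* For y orthogonal to neither x nor z, but x orthogonal to z, the vector     *)
(* x + y is orthogonal to none of x, y, z.                                    *)
Let G_right U x y z : isov Omega U -> \dim U = d ->
  x \in perp U -> y \in perp U -> z \in perp U ->
  '[x, y] != 0 -> '[y, z] != 0 -> G U x y = G U y z.
Proof.
move=> isoU dU.
have triangle u v w : u \in perp U -> v \in perp U -> w \in perp U ->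
    '[u, v] != 0 -> '[v, w] != 0 -> '[u, w] != 0 -> G U u v = G U v w.
  move=> uU vU wU uv vw uw.
  have h a b := @hyper_image U a b isoU dU.
  have [[[_ _] _ _ dG _] [_ _ _ dG' _]] := (h u v uU vU uv, h v w vU wU vw).
  apply/eqP; rewrite eqEdim /G dG dG' leqnn andbT subv_cap capvSr.
  by apply: hyper_adjacent_cap; apply: h.
move=> xU yU zU xy yz; have [xz|xz] := eqVneq '[x, z] 0; last exact: triangle.
have wU : x + y \in perp U by rewrite memvD.
have yw : '[y, x + y] != 0.
  by rewrite formDr (form_alt sympO) addr0 form_eq0C.
rewrite (triangle x y (x + y)) //; last first.
  by rewrite formDr (form_alt sympO) add0r.
rewrite GC (triangle (x + y) y z) //.
  by rewrite form_eq0C.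
by rewrite formDl xz add0r.
Qed.

(** By [G_right], non-orthogonal pairs sharing a vector give the same intersection. Any two such
    pairs are connected by a chain, through [y + y'] when no direct link is found. *)
Lemma hyper_cap_const U : isov Omega U -> \dim U = d ->
  exists W, forall x y, x \in perp U -> y \in perp U -> '[x, y] != 0 ->
    (g (U + <[x]>) :&: g (U + <[y]>))%VS = W.
Proof.
move=> isoU dU.
have [[x [y [xU yU xy]]]|none] := pselect (exists x y,
    [/\ x \in perp U, y \in perp U & '[x, y] != 0]); last first.
  by exists 0%VS => x y xU yU xy; case: none; exists x, y.
exists (G U x y) => x' y' xU' yU' xy'; rewrite -/(G U x' y').
have right a b c := @G_right U a b c isoU dU.
have edge a b : a \in perp U -> b \in perp U -> '[x, a] != 0 -> '[a, b] != 0 ->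
    G U a b = G U x y.
  move=> aU bU xa ab.
  have yx : '[y, x] != 0 by rewrite form_eq0C.
  by rewrite -(right x a b) // -(right y x a) //.
have [xx'|xx'] := boolP ('[x, x'] != 0); first exact: edge.
have [xy1|xy1] := boolP ('[x, y'] != 0); first by rewrite GC edge // form_eq0C.
have [yx'|yx'] := boolP ('[y, x'] != 0).
  by rewrite -(right y x' y') // -(right x y x') //.
move: xx' xy1 yx'; rewrite !negbK => /eqP xx' /eqP xy1 /eqP yx'.
pose w := y + y'.
have wU : w \in perp U by rewrite memvD.
have wx' : '[w, x'] != 0 by rewrite formDl yx' add0r form_eq0C.
have xw : '[x, w] != 0 by rewrite formDr xy1 addr0.
by rewrite -(right w x' y') // edge.
Qed.

(** [g1 U] is the constant of [hyper_cap_const]. On a base it is the intersection of two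
    neighbouring members; every member of the image base arises because neighbours are reflected as
    well as preserved. *)
Lemma descent : exists2 g1, preserves_bases d g1 &
  forall S U, isov Omega S -> \dim S = d.+1 -> (U <= S)%VS -> \dim U = d ->
    (g1 U <= g S)%VS.
Proof.
have ex_W U : exists W, isov Omega U -> \dim U = d ->
    forall x y, x \in perp U -> y \in perp U -> '[x, y] != 0 ->
    (g (U + <[x]>) :&: g (U + <[y]>))%VS = W.
  have [[isoU dU]|none] := pselect (isov Omega U /\ \dim U = d); last first.
    by exists 0%VS => isoU dU; case: none.
  by have [W WP] := hyper_cap_const isoU dU; exists W.
have [g1 g1P] := choice ex_W.
exists g1 => [e fe|S U isoS dS US dU].
  have [e' [phi phiP]] := g_bases fe; have [fe' _ phi_adm phiE] := phiP.
  exists e'.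
  have g1E A i : A \in admissible n d -> i \notin A -> flip i \notin A ->
      g1 (spanf e A) = (spanf e' (phi (i |: A)) :&: spanf e' (phi (flip i |: A)))%VS.
    move=> mA iA fA; have [isoA cA] := admissibleP _ _ mA.
    have iP k : k \notin A -> e (flip k) \in perp (spanf e A).
      move=> kA; rewrite (perp_spanf dimV _ fe) (frame_mem dimV _ _ fe).
      by rewrite !inE flipK.
    rewrite -(g1P _ _ _ (e i) (e (flip i))).
    - rewrite -!spanf1 -!spanfU ![A :|: _]setUC !phiE //.
        by apply: admissibleU1; rewrite ?flipK.
      exact: admissibleU1.
    - by rewrite (isov_spanf dimV _ fe).
    - by rewrite (dim_spanf dimV _ fe).
    - by rewrite -[i]flipK iP.
    - exact: iP.
    exact: frame_neq0.
  apply: base_map_surj => // A mA.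
    have [i iA fA] := ex_fresh mA d_lt_n.
    have [B [k [mB kB fB phi_i phi_f]]] := base_map_fresh fe phiP mA iA fA.
    exists B => //; rewrite (g1E A i) // phi_i phi_f (spanf_cap dimV' _ _ fe').
    by rewrite capU1_flip.
  rename A into B; rename mA into mB.
  have [k kB fB] := ex_fresh mB d_lt_n.
  have mk : k |: B \in admissible n d.+1 by exact: admissibleU1.
  have mf : flip k |: B \in admissible n d.+1 by apply: admissibleU1; rewrite ?flipK.
  have [A1 mA1 defA1] := base_map_onto phiP mk.
  have [A2 mA2 defA2] := base_map_onto phiP mf.
  have : neighbours (phi A1) (phi A2) by rewrite -defA1 -defA2 neighboursU1.
  rewrite (base_map_neighbours _ _ g_bases fe phiP) // => /neighboursP[i iA1 eqA2].
  have [/isotropicP isoA1 _] := admissibleP _ _ mA1.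
  exists (A1 :\ i); first exact: admissibleD1.
  rewrite (g1E _ i) ?admissibleD1 //.
  - rewrite setD1K // -eqA2 -defA1 -defA2 (spanf_cap dimV' _ _ fe').
    by rewrite capU1_flip.
  - by rewrite !inE eqxx.
  by rewrite !inE negb_and isoA1 ?orbT.
have isoU := isovS US isoS.
have /subvPn[x xS xU] : ~~ (S <= U)%VS.
  by apply/negP => /dimvS; rewrite dS dU ltnn.
have defS : (U + <[x]>)%VS = S.
  apply/eqP; rewrite eqEdim subv_add US -memvE xS dS /=.
  rewrite ltnNge; apply: contra xU => dim_le.
  have /eqP-> : U == (U + <[x]>)%VS by rewrite eqEdim addvSl dU.
  by apply: (subvP (addvSr _ _)); exact: memv_line.
(* Such a [y] exhibits [g1 U] as the intersection of [g S] with [g (U + <[y]>)]. *)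
have [y yU xy] := ex_perp_notin dimV sympO xU.
have xU' : x \in perp U.
  by apply: (subvP (perpS _ US)); exact: (subvP isoS).
by rewrite -(g1P U isoU dU x y) // defS capvSl.
Qed.
End Descent.

(** For [m > 1], [x] lies in a hyperplane of [S], so the containments of successive descents
    compose. *)
Lemma descent_to_points m g : (0 < m <= n)%N -> preserves_bases m g ->
  exists2 h, preserves_bases 1 h &
    forall S x, isov Omega S -> \dim S = m -> x \in S -> x != 0 ->
      (h <[x]> <= g S)%VS.
Proof.
elim: m g => [//|[|d] IH] g /andP[_ d_lt_n] g_bases.
  exists g => // S x isoS dS xS x0.
  suff /eqP-> : <[x]>%VS == S by [].
  by rewrite eqEdim -memvE xS dS dim_vline x0.
have [g1 g1_bases g1_sub] := descent d_lt_n g_bases.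
have [|h h_bases h_sub] := IH g1 _ g1_bases; first by rewrite /= (ltnW d_lt_n).
exists h => // S x isoS dS xS x0.
have [e [A [i [fe iA ei defS]]]] := frame_point dimV sympO isoS xS x0.
have cA : #|A| = d.+2 by rewrite -(dim_spanf dimV _ fe) defS.
have /card_gt0P[j] : (0 < #|A :\ i|)%N.
  by have := cardsD1 i A; rewrite iA cA add1n => -[<-].
rewrite !inE => /andP[ji jA].
have US : (spanf e (A :\ j) <= S)%VS.
  by rewrite -defS (spanfS dimV _ _ fe) subsetDl.
have dU : \dim (spanf e (A :\ j)) = d.+1.
  rewrite (dim_spanf dimV _ fe).
  by have := cardsD1 j A; rewrite jA cA add1n => -[<-].
apply: subv_trans (g1_sub S _ isoS dS US dU).
apply: h_sub => //; first exact: isovS US isoS.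
by rewrite -ei mem_frame // !inE eq_sym ji.
Qed.
End BaseMaps.

(** * Points and symplectic bases *)

(** The member of each orbit that comes first in the enumeration gets the sign [false], its image
    the sign [true]. *)
Lemma involution_reindex (T : finType) (tau : T -> T) n :
  #|T| = (2 * n)%N -> involutive tau -> (forall t, tau t != t) ->
  exists2 rho : idx n -> T, injective rho &
    forall i, rho (flip i) = tau (rho i).
Proof.
move=> cT tauK tau_neq; have tau_inj := inv_inj tauK.
pose W := [set t | (enum_rank t < enum_rank (tau t))%N].
have WC t : (tau t \in W) = (t \notin W).
  rewrite !inE tauK -leqNgt ltn_neqAle; case: eqP => //= /val_inj/enum_rank_inj eqt.
  by move: (tau_neq t); rewrite eqt eqxx.
have cW : #|W| = n.
  have tauW : tau @^-1: W = ~: W by apply/setP => t; rewrite in_setC -WC [LHS]in_set.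
  have cWC : #|~: W| = #|W|.
    by rewrite -tauW on_card_preimset //; exists tau => t _; exact: tauK.
  have := cardsC W; rewrite cWC cT; lia.
pose pick (a : 'I_n) : T := enum_val (cast_ord (esym cW) a).
have pickW a : pick a \in W by exact: enum_valP.
have pick_inj : injective pick by move=> a b /enum_val_inj/cast_ord_inj.
exists (fun i => if i.2 then tau (pick i.1) else pick i.1) => [[a b] [c d]|[a []]] /=.
- case: b d => [] [] /=.
  + by move/tau_inj/pick_inj->.
  + by move=> eq_pick; have := pickW c; rewrite -eq_pick WC pickW.
  + by move=> eq_pick; have := pickW a; rewrite eq_pick WC pickW.
  by move/pick_inj->.
- by rewrite tauK.
by [].
Qed.

Section Points.
Variables (n : nat) (F : fieldType) (V : vectType F).
Hypothesis dimV : \dim {:V} = (2 * n)%N.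
Variable Omega : {skew_symmetric V}.
Hypothesis sympO : is_psymplectic Omega.
Implicit Types (p q : proj_point V) (U W : {vspace V}) (A : {set idx n}).
Local Notation perp := (orthov Omega).

Lemma ex_point (x : V) : x != 0 -> exists p, val p = <[x]>%VS.
Proof.
move=> x0; have dx : \dim <[x]> == 1%N by rewrite dim_vline x0.
by exists (exist _ <[x]>%VS dx).
Qed.

Lemma point_line p : exists2 x, x != 0 & val p = <[x]>%VS.
Proof.
have /eqP dp := valP p; have p0 : val p != 0%VS by rewrite -dimv_eq0 dp.
exists (vpick (val p)); first by rewrite vpick0.
by apply/eqP; rewrite eq_sym eqEdim -memvE memv_pick dp dim_vline vpick0 p0.
Qed.

Lemma sub_points U W :
  (forall p, (val p <= U)%VS -> (val p <= W)%VS) -> (U <= W)%VS.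
Proof.
move=> UW; apply/subvP => v vU; have [->|v0] := eqVneq v 0; first exact: mem0v.
by have [p pv] := ex_point v0; rewrite memvE -pv UW // pv -memvE.
Qed.

Lemma totally_isotropicE U : totally_isotropic Omega U <-> isov Omega U.
Proof.
split=> [isoU|isoU p q pU qU].
  apply: sub_points => p pU; rewrite orthov_sym; apply: sub_points => q qU.
  exact: isoU.
rewrite /orthogonal_points; apply: subv_trans pU _; apply: subv_trans isoU _.
exact: perpS.
Qed.

Lemma frame_vec_neq0 (e : idx n -> V) i : frame Omega e -> e i != 0.
Proof.
by move=> fe; apply: contraTneq (frame_neq0 i fe) => ->; rewrite linear0l eqxx.
Qed.

(** Containment becomes orthogonality to frame points, which an orthogonality-preserving map can
    transport. *)
Lemma sub_spanf (e : idx n -> V) A U : frame Omega e ->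
  (U <= spanf e A)%VS <-> forall i, i \notin A -> (U <= perp <[e (flip i)]>)%VS.
Proof.
move=> fe; split=> [UA i iA|UA]; apply/subvP => v vU.
  rewrite mem_orthov1; apply/eqP.
  by have /(mem_spanf dimV _ _ fe) := subvP UA _ vU; apply.
apply/(mem_spanf dimV _ _ fe) => i iA; apply/eqP.
by rewrite -mem_orthov1 (subvP (UA i iA)).
Qed.

Lemma common_frame p q : p != q -> exists e (i j : idx n),
  [/\ frame Omega e, i != j, val p = <[e i]>%VS & val q = <[e j]>%VS].
Proof.
have [x x0 px] := point_line p; have [y y0 qy] := point_line q => pq.
have yx : y \notin <[x]>%VS.
  apply: contra pq => yx; apply/eqP/val_inj; rewrite px qy; apply/eqP.
  by rewrite eq_sym eqEdim -memvE yx !dim_vline x0 y0.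
have [xy|xy] := eqVneq (Omega x y) 0.
  have [e [i [j [fe ij ei ej]]]] := frame_orthogonal dimV sympO x0 yx xy.
  by exists e, i, j; rewrite px qy ei ej.
have iso0 : isov Omega 0 by rewrite /isov sub0v.
have perp0 v : v \in perp 0 by rewrite orthov0 memvf.
have [e [A [i [fe _ _ _ [ei ej]]]]] :=
  frame_hyperbolic dimV sympO iso0 (perp0 x) (perp0 y) xy.
by exists e, i, (flip i); rewrite px qy ei ej eq_sym flip_neq.
Qed.

Local Open Scope classical_set_scope.

Definition frame_points (e : idx n -> V) : set (proj_point V) :=
  [set p | exists i, val p = <[e i]>%VS].

(** The unique non-orthogonal partner defines an involution without fixed points; relabelling turns
    it into [flip]. *)
Lemma symplectic_baseP (B : set (proj_point V)) :
  symplectic_base Omega B <->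
  exists e, frame Omega e /\ B = frame_points e.
Proof.
split=> [[p [[x x_basis px] uniq_p ->]]|[e [fe ->]]].
  have orthE i j : orthogonal_points Omega (p i) (p j) =
      (Omega (tnth x i) (tnth x j) == 0).
    by rewrite /orthogonal_points !px orthov11.
  have tauP i : exists j, forall k, (Omega (tnth x i) (tnth x k) != 0) = (k == j).
    have [j [ij ij_uniq]] := uniq_p i; exists j => k; rewrite -orthE.
    by apply/idP/eqP => [/ij_uniq|->].
  have [tau tauE] := choice tauP.
  have tauK : involutive tau.
    by move=> i; apply/esym/eqP; rewrite -tauE herm_eq0C tauE.
  have tau_neq i : tau i != i.
    by rewrite eq_sym -tauE (form_alt sympO) eqxx.
  have [|rho rho_inj rhoE] := @involution_reindex _ tau n _ tauK tau_neq.
    by rewrite card_ord.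
  exists (fun i => tnth x (rho i)); split.
    by move=> i j; rewrite tauE -rhoE (inj_eq rho_inj).
  have [rho' _ rho'K] : bijective rho.
    by apply: inj_card_bij rho_inj _; rewrite card_idx card_ord dimV mul2n.
  apply/seteqP; split=> [_ [i _ <-]|q [i qi]].
    by exists (rho' i); rewrite px rho'K.
  by exists (rho i) => //; apply: val_inj; rewrite px qi.
have dimE : \dim {:V} = #|{: idx n}| by rewrite card_idx dimV mul2n.
pose r t : idx n := enum_val (cast_ord dimE t).
have r_inj : injective r by move=> s t /enum_val_inj/cast_ord_inj.
have [r' r'K rK] : bijective r.
  by apply: inj_card_bij r_inj _; rewrite card_ord dimE.
have [pt ptE] := choice (fun t => ex_point (frame_vec_neq0 (r t) fe)).
exists pt; split.
- exists [tuple e (r t) | t < \dim {:V}]; last by move=> t; rewrite tnth_mktuple.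
  rewrite basisEdim size_tuple leqnn andbT.
  apply: subv_trans (_ : spanf e setT <= _)%VS; first by rewrite (frame_full dimV fe).
  apply/spanf_subP => i _; apply: memv_span; apply/mapP; exists (r' i).
    by rewrite mem_enum.
  by rewrite rK.
- move=> s; exists (r' (flip (r s))).
  have orthE t : ~~ orthogonal_points Omega (pt s) (pt t) = (r t == flip (r s)).
    by rewrite /orthogonal_points !ptE orthov11 fe.
  split=> [|t]; rewrite orthE ?rK //.
  by move/eqP=> <-; rewrite r'K.
apply/seteqP; split=> [q [i qi]|_ [t _ <-]]; last by exists (r t).
by exists (r' i) => //; apply: val_inj; rewrite ptE rK qi.
Qed.

Lemma base_subset_ofP k (e : idx n -> V) (S : isotropic_grassmannian Omega k) :
  frame Omega e ->
  base_subset_of (frame_points e) S <->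
  exists2 A, A \in admissible n k.+1 & val S = spanf e A.
Proof.
move=> fe; have /set_mem [dS isoS] := valP S.
have spanned A U : (forall i, i \in A -> (<[e i]> <= U)%VS) -> (spanf e A <= U)%VS.
  by move=> AU; apply/spanf_subP => i /AU; rewrite -memvE.
split=> [[X Xe [XS Smin]]|[A mA defS]].
  pose A := [set i | `[< exists2 p, X p & val p = <[e i]>%VS >]]%SET.
  have defS : val S = spanf e A.
    apply/eqP; rewrite eqEsubv; apply/andP; split.
      apply: Smin => p Xp; have [i pi] := Xe _ Xp.
      rewrite /points_of /= pi -memvE; apply: mem_frame; rewrite inE.
      by apply/asboolP; exists p.
    by apply: spanned => i; rewrite inE => /asboolP[p /XS pS <-].
  exists A => //; apply/admissibleP; split.
    by rewrite -(isov_spanf dimV _ fe) -defS; apply/totally_isotropicE.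
  by rewrite -(dim_spanf dimV _ fe) -defS.
exists [set p | exists2 i, i \in A & val p = <[e i]>%VS].
  by move=> p [i _ pi]; exists i.
split=> [p [i iA pi]|W AW]; rewrite /points_of /= defS.
  by rewrite pi -memvE mem_frame.
apply: spanned => i iA; have [p pi] := ex_point (frame_vec_neq0 i fe).
by rewrite -pi; apply: AW; exists i.
Qed.

Lemma ex_isotropic k (e : idx n -> V) A :
  frame Omega e -> A \in admissible n k.+1 ->
  exists S : isotropic_grassmannian Omega k, val S = spanf e A.
Proof.
move=> fe /admissibleP[isoA cA].
have isoS : spanf e A \in isotropic_grassmannian Omega k.
  apply/mem_set; split; first by rewrite (dim_spanf dimV _ fe).
  by apply/totally_isotropicE; rewrite (isov_spanf dimV _ fe).
by exists (exist (fun U => U \in isotropic_grassmannian Omega k) _ isoS).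
Qed.
End Points.

(** * The embedding induced on points *)

Section PointMaps.
Variables (n : nat) (F F' : fieldType) (V : vectType F) (V' : vectType F').
Hypotheses (n_gt0 : (0 < n)%N).
Hypotheses (dimV : \dim {:V} = (2 * n)%N) (dimV' : \dim {:V'} = (2 * n)%N).
Variables (Omega : {skew_symmetric V}) (Omega' : {skew_symmetric V'}).
Hypotheses (sympO : is_psymplectic Omega) (sympO' : is_psymplectic Omega').
Variable h : {vspace V} -> {vspace V'}.
Hypothesis h_bases : preserves_bases n Omega Omega' 1 h.
Implicit Types (p q : proj_point V) (i j : idx n).
Local Notation perp := (orthov Omega).
Local Notation perp' := (orthov Omega').

(** Neighbouring singletons are opposite, so [phi] induces an index map commuting with [flip], and
    composing with it relabels the image frame. *)
Lemma point_frame (e : idx n -> V) : frame Omega e ->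
  exists e', frame Omega' e' /\ forall i, h <[e i]> = <[e' i]>%VS.
Proof.
move=> fe; have [e1 [phi phiP]] := h_bases fe; have [fe1 phi_inj phi_adm phiE] := phiP.
have adm1 i : [set i] \in admissible n 1.
  by apply/admissibleP; rewrite isotropic1 cards1.
have ex_pi i : exists j, phi [set i] = [set j].
  by apply/cards1P/eqP; have /admissibleP[] := phi_adm _ (adm1 i).
have [pi piE] := choice ex_pi.
have pi_inj : injective pi.
  by move=> i j ij; apply/set1_inj/phi_inj; rewrite !piE ij.
have pi_flip i : pi (flip i) = flip (pi i).
  have : neighbours (phi [set i]) (phi [set flip i]).
    rewrite (base_map_neighbours dimV dimV' sympO _ _ h_bases fe phiP) //.
    by apply/neighboursP; exists i; rewrite ?inE // setDv setU0.
  rewrite !piE => /neighboursP[k /set1P->].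
  by rewrite setDv setU0 => /set1_inj.
exists (e1 \o pi); split=> [i j|i] /=.
  by rewrite fe1 -pi_flip (inj_eq pi_inj).
by rewrite -spanf1 phiE // piE spanf1.
Qed.

Lemma dim_point_image p : \dim (h (val p)) == 1%N.
Proof.
have [x x0 ->] := point_line p.
have [e [_ [i [fe _ <- _]]]] :=
  frame_point dimV sympO (isov_line sympO x) (memv_line x) x0.
have [e' [fe' ->]] := point_frame fe.
by rewrite dim_vline (frame_vec_neq0 _ fe').
Qed.

Definition point_map p : proj_point V' := exist _ (h (val p)) (dim_point_image p).

(** In a common frame orthogonality depends on the indices only, and [h] keeps the indices. *)
Lemma point_map_orth p q :
  (h (val p) <= perp' (h (val q)))%VS = (val p <= perp (val q))%VS.
Proof.
have [->|/(common_frame dimV sympO)[e [i [j [fe ij -> ->]]]]] := eqVneq p q.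
  have [y _ yE] := point_line (point_map q).
  have -> : h (val q) = <[y]>%VS := yE; have [x _ ->] := point_line q.
  by rewrite !orthov11 (form_alt sympO) (form_alt sympO') !eqxx.
have [e' [fe' he]] := point_frame fe.
by rewrite !he !orthov11 -[LHS]negbK -[RHS]negbK fe fe'.
Qed.

Lemma point_map_inj : injective point_map.
Proof.
move=> p q pq; apply: contraPeq (congr1 val pq) => /= neq_pq.
have [e [i [j [fe ij -> ->]]]] := common_frame dimV sympO neq_pq.
have [e' [fe' he]] := point_frame fe.
rewrite !he -!spanf1 => /(spanf_inj dimV' fe')/set1_inj eq_ij.
by rewrite eq_ij eqxx in ij.
Qed.

Lemma point_map_sub (e : idx n -> V) (e' : idx n -> V') (A : {set idx n}) p :
  frame Omega e -> frame Omega' e' -> (forall i, h <[e i]> = <[e' i]>%VS) ->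
  (h (val p) <= spanf e' A)%VS = (val p <= spanf e A)%VS.
Proof.
move=> fe fe' he.
have orthE i : (h (val p) <= perp' <[e' i]>)%VS = (val p <= perp <[e i]>)%VS.
  have [q qi] := ex_point (frame_vec_neq0 i fe).
  by rewrite -he -qi point_map_orth.
apply/idP/idP.
  move/(sub_spanf dimV' _ _ fe') => pA; apply/(sub_spanf dimV _ _ fe) => i /pA.
  by rewrite orthE.
move/(sub_spanf dimV _ _ fe) => pA; apply/(sub_spanf dimV' _ _ fe') => i /pA.
by rewrite orthE.
Qed.

Lemma line_frame (L : proj_line V) : exists e (i j : idx n),
  [/\ frame Omega e, i != j & val L = spanf e [set i; j]].
Proof.
have /eqP dL := valP L.
have [p pL] : exists p, (val p <= val L)%VS.
  have L0 : vpick (val L) != 0 by rewrite vpick0 -dimv_eq0 dL.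
  by have [p pE] := ex_point L0; exists p; rewrite pE -memvE memv_pick.
have /subvPn[y yL yp] : ~~ (val L <= val p)%VS.
  by apply/negP => /dimvS; rewrite dL (eqP (valP p)).
have y0 : y != 0 by apply: contraNneq yp => ->; rewrite mem0v.
have [q qE] := ex_point y0.
have qL : (val q <= val L)%VS by rewrite qE -memvE.
have pq : p != q by apply: contraNneq yp => ->; rewrite qE memv_line.
have [e [i [j [fe ij pi qj]]]] := common_frame dimV sympO pq.
exists e, i, j; split=> //; apply/eqP; rewrite eq_sym eqEdim.
rewrite (dim_spanf dimV _ fe) cards2 ij dL leqnn andbT.
by apply/spanf_subP => k; rewrite !inE memvE => /orP[]/eqP->; rewrite -?pi -?qj.
Qed.

Local Open Scope classical_set_scope.

Lemma maps_into_line (e : idx n -> V) (e' : idx n -> V') i j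
    (L : proj_line V) (L' : proj_line V') :
  frame Omega e -> frame Omega' e' -> (forall i, h <[e i]> = <[e' i]>%VS) ->
  i != j -> val L = spanf e [set i; j]%SET ->
  maps_into point_map L L' -> val L' = spanf e' [set i; j]%SET.
Proof.
move=> fe fe' he ij defL LL'; apply/eqP; rewrite eq_sym eqEdim.
rewrite (dim_spanf dimV' _ fe') cards2 ij (eqP (valP L')) leqnn andbT.
apply/spanf_subP => k kij; have [p pk] := ex_point (frame_vec_neq0 k fe).
rewrite memvE -he -pk; apply: (LL' (point_map p)); exists p => //.
by rewrite /points_of /= defL pk -memvE mem_frame.
Qed.

(** In a frame through two points of a line, the image line is spanned by the two image points, and
    by [point_map_sub] only points of the original line map into it. *)
Lemma point_map_embedding : embedding point_map.
Proof.
split=> [|L|L' L1 L2 L1L' L2L'].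
- exact: point_map_inj.
- have [e [i [j [fe ij defL]]]] := line_frame L.
  have [e' [fe' he]] := point_frame fe.
  have dL' : \dim (spanf e' [set i; j]%SET) == 2%N.
    by rewrite (dim_spanf dimV' _ fe') cards2 ij.
  exists (exist (fun U => \dim U == 2%N) _ dL') => _ [p pL <-].
  by rewrite /points_of /= (point_map_sub _ _ fe fe' he) -defL.
have [e [i [j [fe ij defL]]]] := line_frame L1.
have [e' [fe' he]] := point_frame fe.
have defL' := maps_into_line fe fe' he ij defL L1L'.
apply/esym/val_inj/eqP; rewrite eqEdim (eqP (valP L1)) (eqP (valP L2)) leqnn andbT.
apply: sub_points => p pL2; rewrite defL -(point_map_sub _ _ fe fe' he) -defL'.
by apply: (L2L' (point_map p)); exists p.
Qed.

Lemma point_map_symplectic : symplectic_embedding Omega Omega' point_map.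
Proof.
split=> [|B /(symplectic_baseP dimV sympO)[e [fe ->]]].
  exact: point_map_embedding.
have [e' [fe' he]] := point_frame fe.
apply/(symplectic_baseP dimV' sympO'); exists e'; split=> //.
apply/seteqP; split=> [_ [p [i pi] <-]|q [i qi]].
  by exists i; rewrite /= pi he.
have [p pi] := ex_point (frame_vec_neq0 i fe).
by exists p; [exists i | apply: val_inj; rewrite /= pi he qi].
Qed.
End PointMaps.

Local Open Scope classical_set_scope.

Theorem theorem1 (n k : nat) (hn : (1 <= n)%N) (hk : (k < n)%N)
  (F F' : fieldType) (V : vectType F) (V' : vectType F')
  (dimV : \dim {:V} = (2 * n)%N) (dimV' : \dim {:V'} = (2 * n)%N)
  (Omega : {skew_symmetric V}) (Omega' : {skew_symmetric V'})
  (sympO : is_psymplectic Omega) (sympO' : is_psymplectic Omega')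
  (f : isotropic_grassmannian Omega k -> isotropic_grassmannian Omega' k)
  (f_base : forall X : set (isotropic_grassmannian Omega k),
     base_subset X -> base_subset (f @` X)) :
  exists2 h : proj_point V -> proj_point V', symplectic_embedding Omega Omega' h &
    forall S : isotropic_grassmannian Omega k,
      spanned_by (h @` points_of (val S)) (val (f S)).
Proof.
(* [g] extends [f] by zero to all subspaces. *)
pose g U : {vspace V'} := if insub U is Some T then val (f T) else 0%VS.
have gE S : g (val S) = val (f S) by rewrite /g valK.
have g_bases : preserves_bases n Omega Omega' k.+1 g.
  move=> e fe; have base_e : base_subset
      (base_subset_of (frame_points e) : set (isotropic_grassmannian Omega k)).
    exists (frame_points e) => //.
    by apply/(symplectic_baseP dimV sympO); exists e.
  have [B' /(symplectic_baseP dimV' sympO')[e' [fe' ->]] fE] := f_base _ base_e.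
  exists e'; apply: (base_map_surj dimV' fe').
    move=> A mA; have [S defS] := ex_isotropic dimV fe mA.
    have : (f @` base_subset_of (frame_points e))%classic (f S).
      by exists S => //; apply/(base_subset_ofP dimV _ fe); exists A.
    rewrite fE => /(base_subset_ofP dimV' _ fe')[B mB defB].
    by exists B => //; rewrite -defB -defS gE.
  move=> B mB; have [T defT] := ex_isotropic dimV' fe' mB.
  have : base_subset_of (frame_points e') T.
    by apply/(base_subset_ofP dimV' _ fe'); exists B.
  rewrite -fE => -[S /(base_subset_ofP dimV _ fe)[A mA defS] fS].
  by exists A => //; rewrite -defS gE fS defT.
(* [hk] is convertible with [0 < k.+1 <= n]. *)
have [h h_bases h_sub] := descent_to_points dimV dimV' sympO (m := k.+1) hk g_bases.
have frames := point_frame hn dimV dimV' sympO h_bases.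
exists (point_map hn dimV dimV' sympO h_bases).
  exact: point_map_symplectic.
move=> S; have /set_mem [dS /totally_isotropicE isoS] := valP S.
have [e [A [fe defS]]] := frame_isov dimV sympO isoS.
have [e' [fe' he]] := frames e fe.
have hS (p : proj_point V) : (val p <= val S)%VS -> (h (val p) <= val (f S))%VS.
  have [x x0 ->] := point_line p; rewrite -memvE -gE => xS; exact: h_sub.
have points_A i : i \in A -> exists2 p : proj_point V,
    val p = <[e i]>%VS & (val p <= val S)%VS.
  move=> iA; have [p pi] := ex_point (frame_vec_neq0 i fe); exists p => //.
  by rewrite pi -defS -memvE mem_frame.
have fSE : val (f S) = spanf e' A.
  have /set_mem [dfS _] := valP (f S).
  apply/eqP; rewrite eq_sym eqEdim dfS (dim_spanf dimV' _ fe').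
  rewrite -(dim_spanf dimV _ fe) defS dS leqnn andbT.
  by apply/spanf_subP => i /points_A[p pi /hS]; rewrite pi he -memvE.
split=> [_ [p pS <-]|W hW]; first exact: hS.
rewrite fSE; apply/spanf_subP => i /points_A[p pi pS].
rewrite memvE -he -pi.
by apply: (hW (point_map hn dimV dimV' sympO h_bases p)); exists p.
Qed.
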